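(* For almost all (in the sense of Lebesgue measure) real numbers $\alpha$ one has both 1) $\displaystyle \lim_{t\to\infty}\frac{I_\alpha(t)}{N(\alpha,t)}=\frac12$, and 2) $\displaystyle \lim_{t\to\infty}\frac{I_\alpha(t)}{\ln t}=\frac{6\ln 2}{\pi^2}$.
   Context: For a real irrational number $\alpha$ and real $t\ge 1$ put $\psi_\alpha(t)=\min_{1\le q\le t}\|q\alpha\|$, where $q$ runs over integers and $\|\cdot\|$ denotes the distance to the nearest integer, and $I_\alpha(t)=\int_1^t\psi_\alpha(\xi)\,d\xi$. Let $\alpha=[a_0;a_1,a_2,\ldots]$ be the regular continued fraction expansion of $\alpha$ and $p_\nu/q_\nu=[a_0;a_1,\ldots,a_\nu]$ ($\nu\ge 0$, in lowest terms, $q_\nu>0$, so $q_0=1$) its convergents. For $t>1$ the integer $N=N(\alpha,t)$ is defined by the condition $q_N\le t<q_{N+1}$. *)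

(* Defs.v *)
From HB Require Import structures.
From mathcomp Require Import all_boot all_order all_algebra.
From mathcomp Require Import all_classical all_reals all_analysis.

Set Implicit Arguments.
Unset Strict Implicit.
Unset Printing Implicit Defensive.

Import Order.TTheory GRing.Theory Num.Theory.
Import numFieldNormedType.Exports.

Local Open Scope classical_set_scope.
Local Open Scope ring_scope.

Definition dist_int (R : realType) (x : R) : R :=
  inf [set `|x - m%:~R| | m in [set: int]].

(* For t >= 1 the infimum is over a finite nonempty set, hence a minimum. *)
Definition psi (R : realType) (alpha t : R) : R :=
  inf [set dist_int (q%:R * alpha) | q in [set q : nat | (1 <= q)%N /\ q%:R <= t]].

Definition I_int (R : realType) (alpha t : R) : R :=
  Rintegral (@lebesgue_measure R) `[1, t] (psi alpha).

(* The complete quotients alpha_0 = alpha, alpha_{n+1} = 1 / {alpha_n};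
   all the fractional parts are nonzero when alpha is irrational. *)
Fixpoint complete_quotient (R : realType) (alpha : R) (n : nat) : R :=
  if n is n'.+1 then
    let x := complete_quotient alpha n' in (x - (Num.floor x)%:~R)^-1
  else alpha.

Definition partial_quotient (R : realType) (alpha : R) (n : nat) : int :=
  Num.floor (complete_quotient alpha n).

(* [a 0; a 1, ..., a n] *)
Fixpoint finite_cf (a : nat -> int) (n : nat) : rat :=
  if n is n'.+1 then (a 0%N)%:~R + (finite_cf (fun k => a k.+1) n')^-1
  else (a 0%N)%:~R.

Definition convergent (R : realType) (alpha : R) (n : nat) : rat :=
  finite_cf (partial_quotient alpha) n.

Definition convergent_den (R : realType) (alpha : R) (n : nat) : int :=
  denq (convergent alpha n).

(* For alpha irrational and t >= 1 exactly one N satisfies the condition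
   (q_0 = 1 and q_0 <= q_1 < q_2 < ... is unbounded); the default value 0 of
   xget is then irrelevant. *)
Definition cf_index (R : realType) (alpha t : R) : nat :=
  xget 0%N [set N : nat | (convergent_den alpha N)%:~R <= t
                        /\ t < (convergent_den alpha N.+1)%:~R].

(* Main.v *)
Require Import Defs.
From HB Require Import structures.
From mathcomp Require Import all_boot all_order all_algebra.
From mathcomp Require Import all_classical all_reals all_analysis.
From mathcomp Require Import ring lra zify.

(** Let q_n be the denominators of the convergents of alpha, and d_n the distance
from q_n alpha to the nearest integer. By best approximation, psi equals d_n on
[q_n, q_(n+1)), so that I(t) differs by at most 1 from the sum over n < N of the
gaps (q_(n+1) - q_n) d_n. Part 1 says that the gaps have mean 1/2 for almost
every alpha. Part 2 follows from part 1 and the theorem of Khinchin and Levy,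
ln q_n / n --> pi^2 / (12 ln 2), because ln t lies between ln q_N and
ln q_(N+1).

Both averages are computed on the tree of digits. The numbers whose first digits
form a given word w fill an interval, the cylinder of w. The fraction of this
interval that belongs to each possible next digit depends only on the ratio
V = q_(n-1) / q_n. Hence, under Lebesgue measure, the successive ratios form a
Markov chain, whose transition operator U is [gauss_op] below. A function D of
words whose mean over the children of every word is 0, and whose second moment
there is bounded, obeys a strong law of large numbers along the digits of almost
every number ([martingale_slln]). Its proof needs no integral: Chebyshev's
inequality goes down the tree by induction and uses only that the measure is
countably subadditive ([exceed_measure]). One then passes to square times, uses
Borel-Cantelli, and interpolates.

For part 1, the sum of the first n gaps, restricted to a cylinder, is an affine
function of alpha whose oscillation is at most 1. Its mean over the cylinder,
minus n / 2 and minus 1 / (2 (1 + V)), has mean increment 0 over the children of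
every word, by a telescoping series ([gap_increment_mean0]). So the gaps have
mean 1/2 ([cf_gap_mean]).

For the theorem of Khinchin and Levy, ln q_n is the sum of the - ln V_i. An
explicit function whose image under U telescopes allows one to replace - ln v by
the bounded function (1 + v) ln (1 + v) / v ([ln_den_levy_fun]). Since U^2 keeps
functions nondecreasing and divides their oscillation by 4
([gauss_op2_osc]), the averages of this function along the digits converge almost
everywhere to a constant c ([avg_cvg]). To find c, take the sum of
f (a / b) / (b (a + b)) over the pairs 1 <= a <= b <= X. Up to a bounded error
it does not change when f is replaced by U f, because the maps
(a, b) |-> (b, k b + a) of Euclid's algorithm enumerate the pairs with
a < b ([lattice_sum_op]). It grows like ln X, so c is the ratio of two limits of
Riemann sums ([lattice_mean]): ln 2 for f = 1, and the sum of (-1)^j / (j + 1)^2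
for the function above. The latter is pi^2 / 12, since the sum of the inverse
squares of the sines of the odd multiples of pi / 2^(n+2) below pi / 2 has a
closed form ([sum_csc_sqr]). *)

Set Implicit Arguments.
Unset Strict Implicit.
Unset Printing Implicit Defensive.

Import Order.TTheory GRing.Theory Num.Theory.
Import numFieldNormedType.Exports.

Local Open Scope classical_set_scope.
Local Open Scope ring_scope.

(** * Cylinders of continued fraction digits *)

Section cylinders.
Context {R : realType}.
Implicit Types (w : seq nat) (v : R) (k n : nat).

(** The fraction of a cylinder with ratio [v] = q_(n-1) / q_n that is filled by the
numbers whose next digit is [k.+1]. *)
Definition digit_prob v k : R := (1 + v) / ((k.+1%:R + v) * (k.+2%:R + v)).

(** A word lists the digits of a number with the latest one first, and the entry [k]
stands for the partial quotient k + 1, so that every list of naturals is a word.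
With this order the ratio q_(n-1) / q_n of a word obeys a recursion on lists. *)
Fixpoint qratio w : R := if w is k :: w' then (k.+1%:R + qratio w')^-1 else 0.

Fixpoint cyl_len w : R :=
  if w is k :: w' then cyl_len w' * digit_prob (qratio w') k else 1.

(** The number (p_n + p_(n-1) x) / (q_n + q_(n-1) x) divides the cylinder of its first
n digits in this proportion, where v = q_(n-1) / q_n. *)
Definition cyl_pos v x : R := x * (1 + v) / (1 + v * x).

(** The endpoints p_n / q_n and (p_n + p_(n-1)) / (q_n + q_(n-1)) of a cylinder, in this
order, which is decreasing for words of odd length. Going down the tree they are
given by the previous endpoints and the ratio alone. *)
Fixpoint cyl_ends (m : R) w : R * R :=
  if w is k :: w' then
    let e := cyl_ends m w' in let v := qratio w' in
    (e.1 + (e.2 - e.1) * ((1 + v) / (k.+1%:R + v)),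
     e.1 + (e.2 - e.1) * ((1 + v) / (k.+2%:R + v)))
  else (m, m + 1).

Definition cylinder (m : R) w : set R :=
  let e := cyl_ends m w in `[Num.min e.1 e.2, Num.max e.1 e.2].

Lemma digit_den_gt0 v k : 0 <= v -> 0 < k.+1%:R + v.
Proof. by move=> v0; rewrite ltr_wpDr// ltr0n. Qed.

Lemma digit_prob_gt0 v k : 0 <= v -> 0 < digit_prob v k.
Proof.
move=> v0; rewrite divr_gt0 ?mulr_gt0 ?digit_den_gt0//.
by rewrite -[1]/(1%:R) digit_den_gt0.
Qed.

Lemma sum_digit_prob v n : 0 <= v ->
  \sum_(k < n) digit_prob v k = n%:R / (n.+1%:R + v).
Proof.
move=> v0; elim: n => [|n ih]; first by rewrite big_ord0 mul0r.
rewrite big_ord_recr /= ih /digit_prob -!natr1.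
have n0 : 0 <= n%:R :> R by [].
by field; rewrite !gt_eqF//; lra.
Qed.

Lemma sum_digit_prob_le1 v n : 0 <= v -> \sum_(k < n) digit_prob v k <= 1.
Proof.
move=> v0; rewrite sum_digit_prob// ler_pdivrMr ?digit_den_gt0// mul1r.
by rewrite -natr1; lra.
Qed.

Lemma qratio_ge0 w : 0 <= qratio w.
Proof.
by elim: w => //= k w ih; rewrite invr_ge0 ltW// digit_den_gt0.
Qed.

Lemma qratio_le1 w : qratio w <= 1.
Proof.
case: w => //= k w; rewrite invf_le1 ?digit_den_gt0 ?qratio_ge0//.
by rewrite -natr1; have := qratio_ge0 w; have : 0 <= k%:R :> R by []; lra.
Qed.

Lemma cyl_len_gt0 w : 0 < cyl_len w.
Proof. by elim: w => //= k w ih; rewrite mulr_gt0// digit_prob_gt0 ?qratio_ge0. Qed.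

Lemma cyl_endsB m w :
  (cyl_ends m w).2 - (cyl_ends m w).1 = (-1) ^+ size w * cyl_len w.
Proof.
elim: w => [|k w ih] /=; first by rewrite expr0; ring.
rewrite exprS -mulrA [X in -1 * X]mulrA -ih /digit_prob -!natr1.
have := qratio_ge0 w; have n0 : 0 <= k%:R :> R by [].
by move=> ?; field; rewrite !gt_eqF//; lra.
Qed.

Lemma measurable_cylinder m w : measurable (cylinder m w).
Proof. exact: measurable_itv. Qed.

Lemma cylinder_measure m w :
  (@lebesgue_measure R (cylinder m w) <= (cyl_len w)%:E)%E.
Proof.
rewrite /cylinder lebesgue_measure_itv /=; case: ifPn => _; last first.
  by rewrite lee_fin ltW// cyl_len_gt0.
rewrite -EFinB lee_fin.
have -> : forall a b : R, Num.max a b - Num.min a b = `|b - a|.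
  by move=> a b; rewrite distrC maxr_absE minr_absE; lra.
by rewrite cyl_endsB normrM normrX normrN1 expr1n mul1r ger0_norm// ltW// cyl_len_gt0.
Qed.

Lemma cyl_pos_ge0_le1 v x : 0 <= v -> 0 <= x <= 1 -> 0 <= cyl_pos v x <= 1.
Proof.
move=> v0 /andP[x0 x1]; have vx : 0 <= v * x by rewrite mulr_ge0.
rewrite /cyl_pos divr_ge0 ?mulr_ge0//=; try lra.
by rewrite ler_pdivrMr; nra.
Qed.

Lemma mem_cylinder m w t : 0 <= t <= 1 ->
  cylinder m w ((cyl_ends m w).1 + ((cyl_ends m w).2 - (cyl_ends m w).1) * t).
Proof.
rewrite /cylinder /= in_itv /=; case: (cyl_ends m w) => a b /= /andP[t0 t1].
by rewrite ge_min le_max; case: (leP a b) => ab; apply/andP; split; apply/orP; 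
  (try by [left; nra]); (try by [right; nra]).
Qed.

(** Reading one more digit, that is writing x = 1 / (k + 1 + x'), does not move the
point, only the cylinder in which it is located. *)
Lemma cyl_pos_step m w k x : 0 <= x ->
  let e := cyl_ends m w in let e' := cyl_ends m (k :: w) in
  e.1 + (e.2 - e.1) * cyl_pos (qratio w) (k.+1%:R + x)^-1 =
  e'.1 + (e'.2 - e'.1) * cyl_pos (qratio (k :: w)) x.
Proof.
move=> x0 /=; case: (cyl_ends m w) => a b /=.
have := qratio_ge0 w; have n0 : 0 <= k%:R :> R by [].
set v := qratio w => v0; rewrite /cyl_pos -!natr1.
by field; rewrite !gt_eqF//; try lra; nra.
Qed.
End cylinders.

(** * A Markov inequality on the tree of digits *)

Section tree_markov.
Context {R : realType}.
Implicit Types (w : seq nat) (n k : nat) (m K : R) (Q : seq nat -> R).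
Local Notation mu := (@lebesgue_measure R).

(** An event that depends on [j] further digits, defined by descent so that its measure is
bounded by induction on the remaining depth. *)
Fixpoint exceed m Q K j w : set R :=
  if j is j'.+1 then \bigcup_k exceed m Q K j' (k :: w)
  else if K <= Q w then cylinder m w else set0.

Lemma measurable_exceed m Q K j w : measurable (exceed m Q K j w).
Proof.
elim: j w => [|j ih] w /=; last by apply: bigcupT_measurable => k; exact: ih.
by case: ifP => // _; exact: measurable_cylinder.
Qed.

Lemma nneseries_le_bound (u : nat -> \bar R) (b : \bar R) :
  (forall k, 0 <= u k)%E -> (forall n, \sum_(k < n) u k <= b)%E ->
  (\sum_(0 <= k <oo) u k <= b)%E.
Proof.
move=> u0 ub; apply: lime_le; first by apply: is_cvg_nneseries => k _ _.
by apply: nearW => n; rewrite big_mkord.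
Qed.

(** Markov's inequality for a nonnegative supermartingale. The bound is immediate on the
last level, and countable subadditivity carries it from the children to their parent. *)
Lemma exceed_measure m Q K n : 0 < K -> (forall w, 0 <= Q w) ->
  (forall w N, (size w < n)%N ->
    \sum_(k < N) digit_prob (qratio w) k * Q ((k : nat) :: w) <= Q w) ->
  forall j w, (size w + j)%N = n ->
  (mu (exceed m Q K j w) <= (cyl_len w * Q w / K)%:E)%E.
Proof.
move=> K0 Q0 HQ; elim=> [|j ih] w sw /=.
  have wQ : 0 <= cyl_len w * Q w / K.
    by rewrite divr_ge0 ?mulr_ge0 ?Q0 ?ltW// cyl_len_gt0.
  case: ifPn => [KQ|_]; last by rewrite measure0 lee_fin.
  apply: (le_trans (cylinder_measure _ _)); rewrite lee_fin -mulrA ler_peMr//.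
    by rewrite ltW// cyl_len_gt0.
  by rewrite ler_pdivlMr// mul1r.
apply: (@le_trans _ _ (\sum_(0 <= k <oo) (mu (exceed m Q K j (k :: w))))%E).
  apply: measure_sigma_subadditive => //.
    by move=> k; exact: measurable_exceed.
  by apply: bigcupT_measurable => k; exact: measurable_exceed.
apply: nneseries_le_bound => // N.
apply: (@le_trans _ _ (\sum_(k < N) (cyl_len ((k : nat) :: w) * Q ((k : nat) :: w) / K)%:E)%E).
  by apply: lee_sum => k _; apply: ih; rewrite /= addSnnS.
rewrite sumEFin lee_fin -mulr_suml ler_pM2r ?invr_gt0//.
under eq_bigr do rewrite /= -mulrA.
rewrite -mulr_sumr ler_pM2l ?cyl_len_gt0//; apply: HQ.
by rewrite -sw addnS ltnS leq_addr.
Qed.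
End tree_markov.

Section digits_of_a_number.
Context {R : realType}.
Implicit Types (alpha : R) (n k : nat).

(** The number x in alpha = (p_n + p_(n-1) x) / (q_n + q_(n-1) x). *)
Definition cf_tail alpha n : R :=
  complete_quotient alpha n - (Num.floor (complete_quotient alpha n))%:~R.

Fixpoint cf_word alpha n : seq nat :=
  if n is n'.+1 then `|partial_quotient alpha n|%N.-1 :: cf_word alpha n'
  else [::].

Lemma irrational_complete_quotient alpha n :
  irrational alpha -> irrational (complete_quotient alpha n).
Proof.
move=> ia; elim: n => [//|n ih] /= [q _ qE]; apply: ih.
exists (q^-1 + (Num.floor (complete_quotient alpha n))%:~R) => //.
by rewrite rmorphD /= fmorphV /= qE invrK ratr_int subrK.
Qed.

Lemma cf_tail_itv alpha n : irrational alpha -> 0 < cf_tail alpha n < 1.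
Proof.
move=> ia; have := @irrational_complete_quotient alpha n ia.
rewrite /cf_tail; set c := complete_quotient alpha n => ic.
have /andP[l u] := floor_itv c; rewrite intrD in u.
apply/andP; split; last by lra.
rewrite subr_gt0 lt_neqAle l andbT; apply/eqP => E; apply: ic.
by exists (Num.floor c)%:~R => //; rewrite ratr_int.
Qed.

Lemma cf_tailV alpha n : irrational alpha ->
  (cf_tail alpha n)^-1 =
  (head 0%N (cf_word alpha n.+1)).+1%:R + cf_tail alpha n.+1.
Proof.
move=> ia; have /andP[x0 x1] := @cf_tail_itv alpha n ia.
rewrite {2}/cf_tail /= -/(cf_tail alpha n) /partial_quotient /= -/(cf_tail alpha n).
set c := (cf_tail alpha n)^-1.
have c1 : 1 <= c by rewrite invf_ge1// ltW.
have : 0 < Num.floor c by rewrite floor_gt0.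
case: (Num.floor c) => // -[//|k] _ /=.
by rewrite addrC subrK.
Qed.

Lemma cf_word_pos alpha n : irrational alpha ->
  let e := cyl_ends (Num.floor alpha)%:~R (cf_word alpha n) in
  alpha = e.1 + (e.2 - e.1) *
     cyl_pos (qratio (cf_word alpha n)) (cf_tail alpha n).
Proof.
move=> ia; elim: n => [|n ih].
  by rewrite /= /cyl_pos /cf_tail /= mul0r !addr0 divr1; ring.
have /andP[x0 x1] := @cf_tail_itv alpha n ia.
have /andP[y0 y1] := @cf_tail_itv alpha n.+1 ia.
have := cyl_pos_step (Num.floor alpha)%:~R (cf_word alpha n)
  (head 0%N (cf_word alpha n.+1)) (ltW y0).
by rewrite -cf_tailV// invrK; exact: etrans.
Qed.

Lemma cf_word_cylinder alpha n : irrational alpha ->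
  cylinder (Num.floor alpha)%:~R (cf_word alpha n) alpha.
Proof.
move=> ia; have /andP[x0 x1] := @cf_tail_itv alpha n ia.
have tE : 0 <= cyl_pos (qratio (cf_word alpha n)) (cf_tail alpha n) <= 1.
  by apply: cyl_pos_ge0_le1; [exact: qratio_ge0|rewrite !ltW].
have := mem_cylinder (Num.floor alpha)%:~R (cf_word alpha n) tE.
by rewrite -(@cf_word_pos alpha n ia).
Qed.

Lemma cf_word_exceed alpha Q K n : irrational alpha ->
  K <= Q (cf_word alpha n) ->
  exceed (Num.floor alpha)%:~R Q K n [::] alpha.
Proof.
move=> ia KQ.
suff H : forall j i, (i + j)%N = n ->
    exceed (Num.floor alpha)%:~R Q K j (cf_word alpha i) alpha.
  exact: (H n 0%N).
elim=> [|j ih] i ij /=.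
  by rewrite addn0 in ij; subst i; rewrite KQ; exact: cf_word_cylinder.
exists `|partial_quotient alpha i.+1|%N.-1 => //.
by apply: (ih i.+1); rewrite addSnnS.
Qed.
End digits_of_a_number.

(** * Convergence of sequences along squares and telescoping series *)

Section convergence_tools.
Context {R : realType}.
Local Notation mu := (@lebesgue_measure R).

Lemma le_cvgn (u : nat -> R) (a l : R) N :
  (forall n, (N <= n)%N -> a <= u n) -> u @ \oo --> l -> a <= l.
Proof.
move=> au ul; rewrite -(cvg_lim _ ul)//; apply: limr_ge.
  by apply/cvg_ex; exists l.
by exists N => // n /= Nn; exact: au.
Qed.

Lemma ge_cvgn (u : nat -> R) (a l : R) N :
  (forall n, (N <= n)%N -> u n <= a) -> u @ \oo --> l -> l <= a.
Proof.
move=> au ul; rewrite -(cvg_lim _ ul)//; apply: limr_le.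
  by apply/cvg_ex; exists l.
by exists N => // n /= Nn; exact: au.
Qed.

Lemma cvgn0P (u : nat -> R) :
  (forall e, 0 < e -> exists N, forall n, (N <= n)%N -> `|u n| <= e) ->
  u @ \oo --> 0.
Proof.
move=> H; apply/cvgr0Pnorm_le => e e0.
by have [N HN] := H e e0; exists N => // n /= /HN.
Qed.

Lemma nat_sqrt n : exists j, (j ^ 2 <= n < j.+1 ^ 2)%N.
Proof.
elim: n => [|n [j /andP[j1 j2]]]; first by exists 0%N.
case: (ltnP n.+1 (j.+1 ^ 2)) => h; first by exists j; rewrite h andbT (leq_trans j1).
exists j.+1; rewrite h/= (leq_ltn_trans j2)// ltn_exp2r//.
Qed.

Lemma decrease_le (M : nat -> R) C : (forall n, M n - C <= M n.+1) ->
  forall n d, M n - C * d%:R <= M (n + d)%N.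
Proof.
move=> MC n; elim=> [|d ih]; first by rewrite mulr0 addn0 subr0.
by rewrite addnS; have := MC (n + d)%N; rewrite -natr1; lra.
Qed.

(** A sequence that loses at most [C] at each step cannot go below its last value at a
square, nor above its next one, by more than C times the distance to that square,
which is at most twice the root. *)
Lemma squares_interpolation (M : nat -> R) C : 0 <= C ->
  (forall n, M n - C <= M n.+1) ->
  (forall e, 0 < e -> exists J, forall j, (J <= j)%N ->
     `|M (j ^ 2)%N| <= e * (j ^ 2)%:R) ->
  M n / n%:R @[n --> \oo] --> 0.
Proof.
move=> C0 MC Msq; apply: cvgn0P => e e0.
have e8 : 0 < e / 8 by rewrite divr_gt0.
have [J HJ] := Msq _ e8.
have [K HK] : exists K : nat, 6 * C / e <= K%:R.
  by exists (Num.trunc (6 * C / e)).+1; rewrite ltW// truncnS_gt.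
(* From here on j^2 <= n < (j+1)^2, where j is beyond J and beyond 6 C / e. *)
exists ((maxn J K).+1 ^ 2)%N => n Nn.
have [j /andP[j1 j2]] := nat_sqrt n.
have : (maxn J K < j.+1)%N by have := leq_ltn_trans Nn j2; rewrite ltn_exp2r// => /ltnW.
rewrite ltnS geq_max => /andP[Jj Kj].
have n0 : 0 < n%:R :> R by rewrite ltr0n (leq_trans _ Nn)// expn_gt0.
have j0 : (0 < j)%N by have := leq_ltn_trans Nn j2; rewrite ltn_exp2r// ltnS => /(leq_trans _); apply.
have := HJ _ Jj; have := HJ _ (leq_trans Jj (leqnSn j)).
have := decrease_le MC (j ^ 2)%N (n - j ^ 2)%N; rewrite subnKC//.
have := decrease_le MC n (j.+1 ^ 2 - n)%N; rewrite subnKC 1?ltnW//.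
rewrite (natrB _ (ltnW j2)) (natrB _ j1) !natrX -natr1.
move: (M n) (M (j.+1 ^ 2)%N) (M (j ^ 2)%N) => z y x.
have cK : 6 * C <= e * j%:R.
  by rewrite [e * _]mulrC -ler_pdivrMr// (le_trans HK)// ler_nat.
have j1r : 1 <= j%:R :> R by rewrite ler1n.
have j1' : j%:R ^+ 2 <= n%:R :> R by rewrite -natrX ler_nat.
have j2' : n%:R <= (j%:R + 1) ^+ 2 :> R by rewrite natr1 -natrX ler_nat ltnW.
move: (j%:R : R) (n%:R : R) n0 j1r j1' j2' cK => r s s0 r1 rs sr cK h1 h2 h3 h4.
have cK' : 6 * C * r <= e * s by nra.
have es : e * (r + 1) ^+ 2 <= 4 * e * s.
  have : (r + 1) ^+ 2 <= 4 * s by nra.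
  nra.
rewrite normf_div (gtr0_norm s0) ler_pdivrMr// ler_norml.
move: h3 h4; rewrite !ler_norml => /andP[h3a h3b] /andP[h4a h4b].
have Cr : C <= C * r by nra.
have er : e * r ^+ 2 <= e * s by nra.
apply/andP; split.
  have : C * (s - r ^+ 2) <= C * (2 * r + 1) by apply: ler_wpM2l => //; nra.
  by nra.
have : C * ((r + 1) ^+ 2 - s) <= C * (2 * r + 1) by apply: ler_wpM2l => //; nra.
by nra.
Qed.

Lemma telescope_series (u G : nat -> R) (l : R) :
  (forall k, u k = G k - G k.+1) -> G @ \oo --> l ->
  series u @ \oo --> G 0%N - l.
Proof.
move=> uE Gl.
have -> : series u = (fun n => G 0%N - G n).
  apply/funext => n; rewrite seriesEnat /=.
  rewrite (eq_big_nat _ _ (F2 := fun k => - (G k.+1 - G k))); last first.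
    by move=> k _; rewrite uE opprB.
  by rewrite sumrN telescope_sumr// opprB.
by apply: cvgB => //; exact: cvg_cst.
Qed.

Lemma cvg_inv_shift (v : R) : 0 <= v -> (k.+1%:R + v)^-1 @[k --> \oo] --> (0 : R).
Proof.
move=> v0; apply: (@squeeze_cvgr _ _ _ _ (fun=> 0) (@harmonic R)) => //.
- apply: nearW => k /=; rewrite invr_ge0 ltW ?digit_den_gt0//=.
  by rewrite lef_pV2 ?posrE ?digit_den_gt0// lerDl.
- exact: cvg_cst.
- exact: cvg_harmonic.
Qed.

Lemma eq_cvgn (u u' : nat -> R) (l : R) N :
  (forall n, (N <= n)%N -> u' n = u n) -> u @ \oo --> l -> u' @ \oo --> l.
Proof.
move=> uu'; apply: cvg_trans; apply: near_eq_cvg.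
by exists N => // n /= Nn; rewrite uu'.
Qed.

Lemma cvg_bounded_div (u : nat -> R) (C : R) :
  (forall n, `|u n| <= C) -> u n / n%:R @[n --> \oo] --> 0.
Proof.
move=> uC; apply: cvgn0P => e e0.
exists (Num.trunc (C / e)).+1 => n Nn.
have n0 : 0 < n%:R :> R by rewrite ltr0n (leq_trans _ Nn).
rewrite normf_div (gtr0_norm n0) ler_pdivrMr// (le_trans (uC n))//.
rewrite mulrC -ler_pdivrMr// ltW// (lt_le_trans (truncnS_gt _))//.
by rewrite ler_nat.
Qed.

End convergence_tools.

(** * A strong law of large numbers on the tree of digits *)

Section second_moment.
Context {R : realType}.
Local Notation mu := (@lebesgue_measure R).
Implicit Types (D : seq nat -> R).

Fixpoint path_sum D w : R := if w is k :: w' then path_sum D w' + D w else 0.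

Lemma path_sum_cf D (alpha : R) n :
  path_sum D (cf_word alpha n) = \sum_(i < n) D (cf_word alpha i.+1).
Proof. by elim: n => [|n ih]; rewrite ?big_ord0 ?big_ord_recr//= ih. Qed.

(** The square of a sum of increments, plus a bound for the variance of the increments
still to come before time [n]. *)
Definition moment_bound D (C : R) n u : R :=
  path_sum D u ^+ 2 + C * (n - size u)%:R.

(** Given the word [w], the cross term in the square of the next partial sum has mean 0,
and the square of the next increment has mean at most [C]. *)
Lemma second_moment_super D C n w N : 0 <= C ->
  series (fun k => digit_prob (qratio w) k * D (k :: w)) @ \oo --> 0 ->
  (forall N, \sum_(k < N) digit_prob (qratio w) k * D ((k : nat) :: w) ^+ 2 <= C) ->
  (size w < n)%N ->
  \sum_(k < N) digit_prob (qratio w) k * moment_bound D C n ((k : nat) :: w)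
    <= moment_bound D C n w.
Proof.
move=> C0 mean0 var swn.
have p0 k : 0 <= digit_prob (qratio w) k :> R by rewrite ltW// digit_prob_gt0 ?qratio_ge0.
set M := path_sum D w.
have Qw : moment_bound D C n w = M ^+ 2 + C + C * (n - (size w).+1)%:R.
  by rewrite /moment_bound -/M -addrA subnS -{1}(prednK (_ : 0 < n - size w)%N) ?subn_gt0// -natr1; ring.
rewrite Qw /moment_bound /=.
under eq_bigr do rewrite mulrDr.
rewrite big_split /= lerD//; last first.
  rewrite -mulr_suml ler_piMl ?mulr_ge0//.
  by apply: sum_digit_prob_le1; exact: qratio_ge0.
set p := digit_prob (qratio w) in p0 mean0 var *.
have bnd N' : \sum_(k < N') p k * (M + D ((k : nat) :: w)) ^+ 2 <=
    M ^+ 2 + C + 2 * M * series (fun k => p k * D (k :: w)) N'.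
  rewrite seriesEord /= mulr_sumr.
  have -> : \sum_(k < N') p k * (M + D ((k : nat) :: w)) ^+ 2 =
    \sum_(k < N') (M ^+ 2 * p k) + \sum_(k < N') p k * D ((k : nat) :: w) ^+ 2 +
    \sum_(k < N') 2 * M * (p k * D ((k : nat) :: w)).
    by rewrite -!big_split /=; apply: eq_bigr => k _; ring.
  rewrite lerD2r lerD// -mulr_sumr ler_piMr ?sqr_ge0//.
  by apply: sum_digit_prob_le1; exact: qratio_ge0.
(* The partial sums on the left are nondecreasing, and the cross term tends to 0. *)
apply: (@le_cvgn _ (fun N' => M ^+ 2 + C + 2 * M * series (fun k => p k * D (k :: w)) N') _ _ N); last first.
  rewrite -[X in _ --> X]addr0 -(mulr0 (2 * M)).
  by apply: cvgD; [exact: cvg_cst|exact: cvgMl_tmp].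
move=> N' NN'; apply: le_trans (bnd N').
rewrite -(subnKC NN') big_split_ord /= lerDl sumr_ge0// => i _.
by rewrite mulr_ge0 ?sqr_ge0.
Qed.

Lemma sum_inv_sqr_le2 n : \sum_(k < n) (k.+1%:R ^+ 2)^-1 <= 2 :> R.
Proof.
case: n => [|n]; first by rewrite big_ord0.
suff: \sum_(k < n.+1) (k.+1%:R ^+ 2)^-1 <= 2 - n.+1%:R^-1 :> R.
  by move/le_trans; apply; rewrite gerBl invr_ge0.
elim: n => [|n ih]; first by rewrite big_ord1 expr1n invr1; lra.
rewrite big_ord_recr /=; apply: (le_trans (lerD ih (lexx _))).
rewrite -addrA lerD2l -subr_ge0.
have -> : - n.+2%:R^-1 - (- n.+1%:R^-1 + (n.+2%:R ^+ 2)^-1) =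
  (n.+1%:R * n.+2%:R ^+ 2)^-1 :> R.
  by rewrite -!natr1; have : 0 <= n%:R :> R by []; move=> h; field; rewrite !gt_eqF//; lra.
by rewrite invr_ge0 mulr_ge0 ?exprn_ge0.
Qed.
End second_moment.

Section strong_law.
Context {R : realType}.
Local Notation mu := (@lebesgue_measure R).
Implicit Types (D : seq nat -> R).

(** By [exceed_measure] applied to [moment_bound], the partial sum at time j^2 exceeds
eps j^2 with probability at most C / (eps j)^2, which is summable in j. So
Borel-Cantelli applies at square times, and the lower bound on the increments
allows interpolation between squares. An upper bound on the increments is not
assumed: it would fail for logarithms. *)
Lemma martingale_slln D C :
  (forall w, - C <= D w) ->
  (forall w, series (fun k => digit_prob (qratio w) k * D (k :: w)) @ \oo --> 0) ->
  (forall w N,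
    \sum_(k < N) digit_prob (qratio w) k * D ((k : nat) :: w) ^+ 2 <= C) ->
  {ae mu, forall alpha : R, irrational alpha ->
    (\sum_(i < n) D (cf_word alpha i.+1)) / n%:R @[n --> \oo] --> 0}.
Proof.
move=> DC mean0 var.
have C0 : 0 <= C by have := var [::] 0%N; rewrite big_ord0.
(* The event number j concerns time (j+1)^2; a null set is found for each threshold
   eps l and each integer part of alpha, and these are countably many. *)
pose eps (l : nat) : R := l.+1%:R^-1.
have eps0 l : 0 < eps l by rewrite invr_gt0.
pose K l j : R := (eps l * (j.+1 ^ 2)%:R) ^+ 2.
have K0 l j : 0 < K l j by rewrite exprn_gt0// mulr_gt0.
pose F (m : R) l j := exceed m (moment_bound D C (j.+1 ^ 2)) (K l j) (j.+1 ^ 2) [::].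
have mF m l j : measurable (F m l j) by exact: measurable_exceed.
have muF m l j : (mu (F m l j) <= (C / eps l ^+ 2 * (j.+1%:R ^+ 2)^-1)%:E)%E.
  apply: le_trans (exceed_measure m (n := (j.+1 ^ 2)%N) (K0 l j) _ _ _) _ => //.
  - by move=> w; rewrite addr_ge0 ?sqr_ge0// mulr_ge0.
  - by move=> w N swn; exact: second_moment_super.
  - rewrite lee_fin /= /moment_bound /= subn0 expr0n /= add0r mul1r /K.
    rewrite natrX; set J : R := j.+1%:R.
    have J0 : J != 0 by rewrite pnatr_eq0.
    rewrite le_eqVlt; apply/orP; left; apply/eqP.
    have e0 := lt0r_neq0 (eps0 l); move: (eps l) J e0 J0 => E J E0 J0.
    by field; rewrite J0 E0.
have lim0 m l : mu (lim_sup_set (F m l)) = 0%E.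
  apply: lim_sup_set_cvg0; first exact: mF.
  apply: (@le_lt_trans _ _ (C / eps l ^+ 2 * 2)%:E); last by rewrite ltry.
  apply: nneseries_le_bound => // n.
  apply: (@le_trans _ _ (\sum_(j < n) (C / eps l ^+ 2 * (j.+1%:R ^+ 2)^-1)%:E)%E).
    by apply: lee_sum => j _; exact: muF.
  rewrite sumEFin lee_fin -mulr_sumr ler_wpM2l ?sum_inv_sqr_le2//.
  by rewrite divr_ge0// sqr_ge0.
pose Z (i : nat) : R := (odflt (0 : int) (unpickle i))%:~R.
apply: (@negligibleS _ _ _ mu (\bigcup_i \bigcup_l lim_sup_set (F (Z i) l))); last first.
  apply: negligible_bigcup => i; apply: negligible_bigcup => l.
  apply/negligibleP; last exact: lim0.
  by apply: bigcapT_measurable => n; apply: bigcup_measurable => k _; exact: mF.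
move=> alpha /= Halpha; apply: contrapT => notin; apply: Halpha => ia.
have cf_sum n : \sum_(i < n) D (cf_word alpha i.+1) = path_sum D (cf_word alpha n).
  by rewrite path_sum_cf.
under eq_fun do rewrite cf_sum.
apply: (squares_interpolation C0).
  by move=> n /=; rewrite lerD2l; exact: DC.
move=> e e0.
have [l le] : exists l, eps l <= e.
  exists (Num.trunc e^-1); rewrite /eps -[leRHS]invrK lef_pV2 ?posrE ?invr_gt0//.
  by rewrite ltW// truncnS_gt.
have : ~ lim_sup_set (F (Num.floor alpha)%:~R l) alpha.
  move=> inl; apply: notin; exists (pickle (Num.floor alpha)) => //.
  by exists l => //; rewrite /Z pickleK.
move=> /existsNP[n /not_implyP[_ nF]].
exists n.+1 => -[//|j] nj.
have : ~ F (Num.floor alpha)%:~R l j alpha by move=> Fj; apply: nF; exists j.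
move=> nFj; rewrite leNgt; apply/negP => eM; apply: nFj.
apply: cf_word_exceed => //; rewrite /moment_bound.
rewrite -[leLHS]addr0; apply: lerD; last by rewrite mulr_ge0.
rewrite -[leRHS]real_normK ?num_real// /K ler_sqr ?nnegrE ?mulr_ge0//; last exact: ltW.
by apply: le_trans (ltW eM); rewrite ler_wpM2r.
Qed.

End strong_law.

(** * The gaps have mean one half *)

Section gap_martingale.
Context {R : realType}.
Implicit Types (v : R) (w : seq nat).

(** The sum of the first n gaps is an affine function of alpha on a cylinder of n
digits. This is the difference of its values at the second and the first endpoint. *)
Fixpoint gap_slope w : R :=
  if w is k :: w' then
    let v := qratio w in
    - (digit_prob (qratio w') k * gap_slope w') - (1 - v) * v / (1 + v)
  else 0.

(** The increment of the mean of this affine function over the cylinder, corrected by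
n / 2 and by 1 / (2 (1 + V)). The latter function solves the Poisson equation of the
problem: subtracting it removes the dependence on V of the mean increment. *)
Definition gap_increment w : R :=
  if w is k :: w' then
    let v := qratio w' in let v' := qratio w in
    gap_slope w' / 2 * ((1 + v) / (k.+1%:R + v) + (1 + v) / (k.+2%:R + v) - 1)
    + ((1 + v')^-1 - v' - 1 + (1 + v)^-1) / 2
  else 0.

Lemma gap_slope_cons k w : let v := qratio (k :: w) in
  gap_slope (k :: w) =
  - (digit_prob (qratio w) k * gap_slope w) - (1 - v) * v / (1 + v).
Proof. by []. Qed.

Lemma gap_increment_cons k w :
  let v := qratio w in let v' := qratio (k :: w) in
  gap_increment (k :: w) =
  gap_slope w / 2 * ((1 + v) / (k.+1%:R + v) + (1 + v) / (k.+2%:R + v) - 1)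
  + ((1 + v')^-1 - v' - 1 + (1 + v)^-1) / 2.
Proof. by []. Qed.

Lemma digit_prob_le_half v k : 0 <= v -> digit_prob v k <= 1 / 2.
Proof.
move=> v0; rewrite /digit_prob ler_pdivrMr; last first.
  by rewrite mulr_gt0 ?digit_den_gt0.
rewrite -[k.+2%:R]natr1 -[k.+1%:R]natr1; have k0 : 0 <= k%:R :> R by [].
by have := mulr_ge0 k0 v0; have := mulr_ge0 k0 k0; have := mulr_ge0 v0 v0; lra.
Qed.

(** The next digit multiplies the slope by a factor at most 1/2 and changes it by at most
1/2. *)
Lemma gap_slope_le1 w : `|gap_slope w| <= 1.
Proof.
elim: w => [|k w ih]; first by rewrite normr0.
rewrite gap_slope_cons; have := qratio_ge0 (R:=R) (k :: w); have := qratio_le1 (R:=R) (k :: w).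
move: (qratio (k :: w)) => v v1 v0.
have p0 := digit_prob_gt0 k (qratio_ge0 (R:=R) w).
have p1 := digit_prob_le_half k (qratio_ge0 (R:=R) w).
move: ih; rewrite !ler_norml => /andP[r0 r1].
have g0 : 0 <= (1 - v) * v / (1 + v) by rewrite divr_ge0//; nra.
have g1 : (1 - v) * v / (1 + v) <= 1 / 2 by rewrite ler_pdivrMr; nra.
by apply/andP; split; nra.
Qed.

Lemma gap_increment_le w : `|gap_increment w| <= 3.
Proof.
case: w => [|k w]; first by rewrite normr0.
rewrite gap_increment_cons.
have := qratio_ge0 (R:=R) (k :: w); have := qratio_le1 (R:=R) (k :: w).
move: (qratio (k :: w)) => v' v'1 v'0.
have := gap_slope_le1 w; rewrite ler_norml => /andP[r0 r1].
have := qratio_ge0 (R:=R) w; have := qratio_le1 (R:=R) w.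
move: (qratio w) => v v1 v0.
have Hf (t : R) : 0 <= t -> t <= 1 -> 1 / 2 <= (1 + t)^-1 <= 1.
  move=> t0 t1; have tp : 0 < 1 + t by lra.
  by rewrite -[(1 + t)^-1]div1r (ler_pdivlMr (1 / 2))// (ler_pdivrMr 1)//; apply/andP; split; lra.
have /andP[a0 a1] := Hf v' v'0 v'1; have /andP[b0 b1] := Hf v v0 v1.
have Hk m : 0 <= (1 + v) / (m.+1%:R + v) <= 1.
  rewrite divr_ge0 ?(ltW (digit_den_gt0 _ _))//=; last by lra.
  by rewrite ler_pdivrMr ?digit_den_gt0// mul1r lerD2r ler1n.
have := Hk k; have := Hk k.+1.
move: ((1 + v) / (k.+2%:R + v)) ((1 + v) / (k.+1%:R + v)).
move=> x y /andP[x0 x1] /andP[y0 y1].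
have z0 : -1 <= y + x - 1 by lra.
have z1 : y + x - 1 <= 1 by lra.
move: (y + x - 1) z0 z1 (gap_slope w) r0 r1 => z z0 z1 r r0 r1.
have rz1 : r * z <= 1 by nra.
have rz0 : -1 <= r * z by nra.
by rewrite ler_norml; apply/andP; split; lra.
Qed.

(** In terms of s = k + 1 + v, the summand is G s - G (s + 1), where G is a polynomial in
1 / s without constant term that vanishes at s = 1 + v. *)
Lemma gap_increment_mean0 w :
  series (fun k => digit_prob (qratio w) k * gap_increment (k :: w)) @ \oo
    --> (0 : R).
Proof.
pose r := gap_slope w / 2; pose v := qratio w : R.
have v0 : 0 <= v := qratio_ge0 w.
pose G (k : nat) : R := let s := (k.+1%:R + v)^-1 in
  s * (r * (1 + v) ^+ 2 * s - r * (1 + v) + (1 + v) * (1 - s) / 2 - v / 2).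
have G0 : G 0%N = 0.
  by rewrite /G /=; field; rewrite gt_eqF//; lra.
rewrite -[X in _ --> X]subr0 -{1}G0; apply: telescope_series.
  move=> k; rewrite /G /= /digit_prob -/r -/v -[k.+2%:R]natr1 -[k.+1%:R]natr1.
  have k0 : 0 <= k%:R :> R by [].
  by field; rewrite !gt_eqF//; lra.
have cs := cvg_inv_shift v0.
rewrite -(mul0r (r * (1 + v) ^+ 2 * 0 - r * (1 + v) + (1 + v) * (1 - 0) / 2 - v / 2)).
apply: cvgM => //; apply: cvgB; last exact: cvg_cst.
apply: cvgD; first by apply: cvgB; [apply: cvgMl_tmp|exact: cvg_cst].
apply: cvgMr_tmp; apply: cvgMl_tmp; apply: cvgB => //; exact: cvg_cst.
Qed.

(** The gap (q_(n+1) - q_n) d_n, as [cf_gapE] shows, in terms of the ratio and the tail. *)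
Definition cf_gap (alpha : R) n : R :=
  let v := qratio (cf_word alpha n.+1) in
  (1 - v) / (1 + v * cf_tail alpha n.+1).

(** The affine function of alpha at its own position in the cylinder is its mean plus the
slope times the distance of that position from 1/2. *)
Lemma sum_cf_gap (alpha : R) n : irrational alpha ->
  let w := cf_word alpha n in let v := qratio w in
  \sum_(i < n) cf_gap alpha i =
  \sum_(i < n) gap_increment (cf_word alpha i.+1) + n%:R / 2
  + gap_slope w * (cyl_pos v (cf_tail alpha n) - 1 / 2) + ((1 + v)^-1 - 1) / 2.
Proof.
move=> ia; elim: n => [|n ih].
  by rewrite !big_ord0 /= addr0 invr1 subrr !mul0r !addr0.
rewrite !big_ord_recr /= {}ih.
have := @cf_tailV R alpha n ia.
have /andP[x0 x1] := @cf_tail_itv R alpha n ia.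
have /andP[y0 y1] := @cf_tail_itv R alpha n.+1 ia.
rewrite [cf_word alpha n.+1]/= [head _ _]/= /cf_gap [cf_word alpha n.+1]/=.
move: (absz _).-1 => k xE.
have {xE} -> : cf_tail alpha n = (k.+1%:R + cf_tail alpha n.+1)^-1.
  by rewrite -xE invrK.
move: y0; set y := cf_tail alpha n.+1 => y0.
have k0 : 0 <= k%:R :> R by [].
have v0 := qratio_ge0 (R:=R) (cf_word alpha n).
rewrite [qratio (k :: _)]/= /digit_prob /cyl_pos -[k.+2%:R]natr1 -[k.+1%:R]natr1.
move: (qratio _) (gap_slope _) (\sum_(i < n) _) v0 => v r S v0.
field; rewrite !gt_eqF//; nra.
Qed.

Lemma cf_gap_mean :
  {ae @lebesgue_measure R, forall alpha : R, irrational alpha ->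
    (\sum_(i < n) cf_gap alpha i) / n%:R @[n --> \oo] --> (1 / 2 : R)}.
Proof.
have : {ae @lebesgue_measure R, forall alpha : R, irrational alpha ->
    (\sum_(i < n) gap_increment (cf_word alpha i.+1)) / n%:R @[n --> \oo] --> 0}.
  apply: (@martingale_slln R gap_increment 9).
  - by move=> w; have := gap_increment_le w; rewrite ler_norml => /andP[+ _]; lra.
  - exact: gap_increment_mean0.
  - move=> w N; apply: (@le_trans _ _ (\sum_(k < N) digit_prob (qratio w) k * 9)).
      apply: ler_sum => k _; rewrite ler_wpM2l ?(ltW (digit_prob_gt0 _ (qratio_ge0 _)))//.
      rewrite -[leLHS]real_normK ?num_real//.
      have -> : 9 = 3 ^+ 2 :> R by rewrite -natrX.
      by rewrite ler_sqr ?nnegrE// gap_increment_le.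
    by rewrite -mulr_suml ler_piMl//; apply: sum_digit_prob_le1; exact: qratio_ge0.
apply: negligibleS => alpha; apply: contra_not => Halpha ia.
have {}Halpha := Halpha ia.
pose E n : R := let w := cf_word alpha n in let v := qratio w in
  gap_slope w * (cyl_pos v (cf_tail alpha n) - 1 / 2) + ((1 + v)^-1 - 1) / 2.
have E1 n : `|E n| <= 1.
  have v0 : 0 <= qratio (cf_word alpha n) :> R := qratio_ge0 _.
  have /andP[x0 x1] := @cf_tail_itv R alpha n ia.
  have /andP[t0 t1] : 0 <= cyl_pos (qratio (cf_word alpha n)) (cf_tail alpha n) <= 1.
    by apply: cyl_pos_ge0_le1 => //; rewrite !ltW.
  have := gap_slope_le1 (cf_word alpha n); rewrite /E /= ler_norml.
  have i0 : 0 <= (1 + qratio (cf_word alpha n))^-1 :> R by rewrite invr_ge0; lra.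
  have i1 : (1 + qratio (cf_word alpha n))^-1 <= 1 :> R.
    by rewrite invf_le1 ?lerDl//; lra.
  move: (gap_slope _) (cyl_pos _ _) t0 t1 ((1 + _)^-1) i0 i1 => r t t0 t1 i i0 i1.
  by move=> /andP[r0 r1]; rewrite ler_norml; apply/andP; split; nra.
apply: (@eq_cvgn R (fun n => (\sum_(i < n) gap_increment (cf_word alpha i.+1)) / n%:R
  + 1 / 2 + E n / n%:R) _ _ 1%N).
  move=> n n1; rewrite sum_cf_gap// /E /=.
  have n0 : n%:R != 0 :> R by rewrite pnatr_eq0 -lt0n.
  by field; rewrite n0 /= gt_eqF//; have := qratio_ge0 (R:=R) (cf_word alpha n); lra.
rewrite -[X in _ --> X]addr0 -[X in _ --> X + _]add0r.
apply: cvgD; last exact: cvg_bounded_div E1.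
by apply: cvgD => //; exact: cvg_cst.
Qed.
End gap_martingale.

(** * Convergents and best approximation *)

Section convergents.
Implicit Types (a : nat -> int) (n : nat).

(** The pair of the values at n - 1 and n of a solution of the recursion
u_n = a_n u_(n-1) + u_(n-2), from its values at -1 and 0. *)
Fixpoint cf_rec a (s : int * int) n : int * int :=
  if n is n'.+1 then
    let t := cf_rec a s n' in (t.2, a n'.+1 * t.2 + t.1)
  else s.

Definition cf_nums a n := cf_rec a (1, a 0%N) n.
Definition cf_dens a n := cf_rec a (0, 1) n.

Lemma cf_numsS a n : cf_nums a n.+1 =
  ((cf_nums a n).2, a n.+1 * (cf_nums a n).2 + (cf_nums a n).1).
Proof. by []. Qed.

Lemma cf_densS a n : cf_dens a n.+1 =
  ((cf_dens a n).2, a n.+1 * (cf_dens a n).2 + (cf_dens a n).1).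
Proof. by []. Qed.

(** [finite_cf] removes the first digit, whereas the recursion adds a last one. The two
agree because a solution of the recursion for a is a combination of the two
solutions for the shifted sequence. *)
Lemma cf_rec_shift a n : let b k := a k.+1 in
  cf_dens a n.+1 = cf_nums b n /\
  cf_nums a n.+1 = (a 0%N * (cf_nums b n).1 + (cf_dens b n).1,
                    a 0%N * (cf_nums b n).2 + (cf_dens b n).2).
Proof.
move=> b; elim: n => [|n [ih1 ih2]].
  by rewrite /cf_dens /cf_nums /= !mulr1 !addr0 mulrC.
split; first by rewrite cf_densS ih1.
rewrite [LHS]cf_numsS ih2 (cf_numsS b) (cf_densS b) /=; congr pair.
by rewrite /b; ring.
Qed.

Lemma cf_dens_gt0 a n : (forall k, 0 < a k.+1) ->
  0 <= (cf_dens a n).1 /\ 0 < (cf_dens a n).2.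
Proof.
move=> a0; elim: n => [//|n [ih1 ih2]]; rewrite cf_densS /=.
by rewrite ltW// ltr_wpDr// mulr_gt0.
Qed.

Lemma finite_cfE a n : (forall k, 0 < a k.+1) ->
  finite_cf a n = (cf_nums a n).2%:~R / (cf_dens a n).2%:~R.
Proof.
elim: n a => [|n ih] a a0; first by rewrite /= divr1.
have [E1 E2] := cf_rec_shift a n.
have [_] := cf_dens_gt0 n.+1 a0; rewrite E1 => b0.
rewrite E2 /= ih; last by move=> k; exact: a0.
by rewrite invf_div intrD intrM; field; rewrite intr_eq0 gt_eqF.
Qed.

Lemma cf_det a n :
  (cf_nums a n).2 * (cf_dens a n).1 - (cf_nums a n).1 * (cf_dens a n).2
  = - (-1) ^+ n.
Proof.
elim: n => [|n ih]; first by rewrite /= expr0; ring.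
rewrite cf_numsS cf_densS /= exprS mulN1r -ih.
by ring.
Qed.

Lemma denq_finite_cf a n : (forall k, 0 < a k.+1) ->
  denq (finite_cf a n) = (cf_dens a n).2.
Proof.
move=> a0; have [_ d0] := cf_dens_gt0 n a0.
rewrite finite_cfE// coprimeq_den; first by rewrite gt_eqF// gtr0_norm.
rewrite -[coprime _ _]/(coprimez _ _); apply/coprimezP.
exists (- (-1) ^+ n * (cf_dens a n).1, (-1) ^+ n * (cf_nums a n).1) => /=.
have s2 : (-1) ^+ n * (-1) ^+ n = 1 :> int by rewrite -expr2 sqrr_sign.
have D := cf_det a n; apply: etrans s2.
transitivity (- (-1) ^+ n * ((cf_nums a n).2 * (cf_dens a n).1 -
   (cf_nums a n).1 * (cf_dens a n).2)); first by ring.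
by rewrite D; ring.
Qed.
End convergents.

Section approximation.
Context {R : realType}.
Implicit Types (alpha : R) (n : nat).

Definition cf_num alpha n : int := (cf_nums (partial_quotient alpha) n).2.
Definition cf_den alpha n : int := (cf_dens (partial_quotient alpha) n).2.
Definition cf_dist alpha n : R := `|(cf_den alpha n)%:~R * alpha - (cf_num alpha n)%:~R|.

Lemma partial_quotient_gt0 alpha n : irrational alpha ->
  0 < partial_quotient alpha n.+1.
Proof.
move=> ia; have /andP[x0 x1] := @cf_tail_itv R alpha n ia.
by rewrite /partial_quotient /= -/(cf_tail alpha n) floor_gt0 invf_ge1// ltW.
Qed.

Lemma cf_tailV_int alpha n : irrational alpha ->
  (cf_tail alpha n)^-1 = (partial_quotient alpha n.+1)%:~R + cf_tail alpha n.+1.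
Proof. by move=> ia; rewrite [cf_tail alpha n.+1]/cf_tail addrC subrK. Qed.

Lemma convergent_denE alpha n : irrational alpha ->
  convergent_den alpha n = cf_den alpha n.
Proof.
by move=> ia; apply: denq_finite_cf => k; exact: partial_quotient_gt0.
Qed.

Lemma cf_den_gt0 alpha n : irrational alpha -> 0 < cf_den alpha n.
Proof.
by move=> ia; apply: (cf_dens_gt0 n _).2 => k; exact: partial_quotient_gt0.
Qed.

Lemma cf_denSS alpha n :
  cf_den alpha n.+2 = partial_quotient alpha n.+2 * cf_den alpha n.+1 + cf_den alpha n.
Proof. by []. Qed.

Lemma cf_den_nondecreasing alpha m n : irrational alpha -> (m <= n)%N ->
  cf_den alpha m <= cf_den alpha n.
Proof.
move=> ia; move=> /subnKC <-; elim: (n - m)%N => [|d ih]; first by rewrite addn0.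
rewrite addnS; apply: le_trans ih _.
have a0 := partial_quotient_gt0 (m + d)%N ia.
have [d0 d1] := cf_dens_gt0 (m + d)%N (fun k => partial_quotient_gt0 k ia).
by rewrite /cf_den cf_densS /= ler_wpDr// ler_peMl// ltW.
Qed.

Lemma cf_den_ge alpha n : irrational alpha -> n%:Z <= cf_den alpha n.+1.
Proof.
move=> ia; elim: n => [|n ih]; first by rewrite ltW// cf_den_gt0.
have a0 := partial_quotient_gt0 n.+1 ia.
have d0 := cf_den_gt0 n ia; have d1 := cf_den_gt0 n.+1 ia.
rewrite cf_denSS intS addrC lerD//; first by rewrite (le_trans ih)// ler_peMl// ltW.
Qed.

(** The errors q_n alpha - p_n satisfy the same recursion as q_n, and their successive
quotients are minus the tails. So they alternate in sign. *)
Lemma cf_error_step alpha n : irrational alpha ->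
  (cf_den alpha n.+1)%:~R * alpha - (cf_num alpha n.+1)%:~R =
  - cf_tail alpha n.+1 * ((cf_den alpha n)%:~R * alpha - (cf_num alpha n)%:~R).
Proof.
move=> ia.
pose s := cf_dens (partial_quotient alpha); pose t := cf_nums (partial_quotient alpha).
suff H k : (s k).2%:~R * alpha - (t k).2%:~R =
   - cf_tail alpha k * ((s k).1%:~R * alpha - (t k).1%:~R) by exact: (H n.+1).
elim: k => [|k ih]; first by rewrite /= /cf_tail /= /partial_quotient /=; ring.
rewrite /s /t cf_densS cf_numsS -/s -/t.
change ((partial_quotient alpha k.+1 * (s k).2 + (s k).1)%:~R * alpha -
  (partial_quotient alpha k.+1 * (t k).2 + (t k).1)%:~R =
  - cf_tail alpha k.+1 * ((s k).2%:~R * alpha - (t k).2%:~R)).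
have /andP[x0 x1] := @cf_tail_itv R alpha k ia.
have E := cf_tailV_int k ia.
rewrite !intrD !intrM.
have E1 : (s k).1%:~R * alpha - (t k).1%:~R =
   - (cf_tail alpha k)^-1 * ((s k).2%:~R * alpha - (t k).2%:~R).
  by rewrite ih mulrA mulrNN mulVf ?mul1r// gt_eqF.
rewrite E in E1.
have {}E1 : (s k).1%:~R * alpha = (t k).1%:~R +
   - ((partial_quotient alpha k.+1)%:~R + cf_tail alpha k.+1) *
   ((s k).2%:~R * alpha - (t k).2%:~R) by rewrite -E1 addrC subrK.
by rewrite mulrDl E1; ring.
Qed.

Lemma cf_dist_step alpha n : irrational alpha ->
  cf_dist alpha n.+1 = cf_tail alpha n.+1 * cf_dist alpha n.
Proof.
move=> ia; rewrite /cf_dist cf_error_step// normrM normrN (ger0_norm (_ : 0 <= cf_tail _ _))//.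
by rewrite ltW//; have /andP[] := @cf_tail_itv R alpha n.+1 ia.
Qed.

Lemma cf_dist0 alpha : irrational alpha -> cf_dist alpha 0 = cf_tail alpha 0.
Proof.
move=> ia; rewrite /cf_dist /cf_den /cf_num /= mul1r /partial_quotient /=.
by rewrite ger0_norm// ltW//; have /andP[] := @cf_tail_itv R alpha 0 ia.
Qed.

Lemma cf_dist_den alpha n : irrational alpha ->
  cf_dist alpha n *
  ((cf_den alpha n.+1)%:~R + cf_tail alpha n.+1 * (cf_den alpha n)%:~R) = 1.
Proof.
move=> ia; have xN0 k : cf_tail alpha k != 0.
  by rewrite gt_eqF//; have /andP[] := @cf_tail_itv R alpha k ia.
elim: n => [|n ih].
  rewrite cf_dist0// /cf_den /= mulr1 addr0 mulr1.
  by rewrite -cf_tailV_int// mulfV.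
rewrite cf_dist_step// -{}[RHS]ih cf_denSS intrD intrM.
have -> : (partial_quotient alpha n.+2)%:~R * (cf_den alpha n.+1)%:~R +
   (cf_den alpha n)%:~R + cf_tail alpha n.+2 * (cf_den alpha n.+1)%:~R =
   (cf_tail alpha n.+1)^-1 * (cf_den alpha n.+1)%:~R + (cf_den alpha n)%:~R.
  by rewrite cf_tailV_int//; ring.
by field.
Qed.

Lemma qratio_cf_den alpha n : irrational alpha ->
  qratio (cf_word alpha n.+1) =
  (cf_den alpha n)%:~R / (cf_den alpha n.+1)%:~R :> R.
Proof.
move=> ia; pose s := cf_dens (partial_quotient alpha).
suff H k : qratio (cf_word alpha k) = (s k).1%:~R / (s k).2%:~R :> R.
  exact: (H n.+1).
elim: k => [|k ih]; first by rewrite /= mul0r.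
have [_ d0] := cf_dens_gt0 k (fun j => partial_quotient_gt0 j ia).
have a0 := partial_quotient_gt0 k ia.
have -> : qratio (cf_word alpha k.+1) =
    ((partial_quotient alpha k.+1)%:~R + qratio (cf_word alpha k))^-1 :> R.
  rewrite [cf_word alpha k.+1]/=; case: (partial_quotient alpha k.+1) a0 => //.
  by case.
rewrite ih /s cf_densS -/s.
change (((partial_quotient alpha k.+1)%:~R + (s k).1%:~R / (s k).2%:~R)^-1 =
  (s k).2%:~R / (partial_quotient alpha k.+1 * (s k).2 + (s k).1)%:~R :> R).
rewrite intrD intrM -[RHS]invf_div; congr (_ ^-1).
by field; rewrite intr_eq0 gt_eqF.
Qed.

Lemma cf_gapE alpha n : irrational alpha ->
  cf_gap alpha n =
  ((cf_den alpha n.+1)%:~R - (cf_den alpha n)%:~R) * cf_dist alpha n.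
Proof.
move=> ia; have E := cf_dist_den n ia; rewrite /cf_gap qratio_cf_den//.
have q1 : 0 < (cf_den alpha n.+1)%:~R :> R by rewrite ltr0z cf_den_gt0.
have q0 : 0 < (cf_den alpha n)%:~R :> R by rewrite ltr0z cf_den_gt0.
have /andP[x0 x1] := @cf_tail_itv R alpha n.+1 ia.
have D0 : 0 < (cf_den alpha n.+1)%:~R + cf_tail alpha n.+1 * (cf_den alpha n)%:~R.
  by rewrite ltr_wpDr// mulr_ge0// ltW.
have -> : cf_dist alpha n = ((cf_den alpha n.+1)%:~R +
    cf_tail alpha n.+1 * (cf_den alpha n)%:~R)^-1.
  by apply: (mulIf (lt0r_neq0 D0)); rewrite E mulVf// gt_eqF.
by field; rewrite !gt_eqF//; rewrite addrC mulrC in D0; lra.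
Qed.

(** Since the determinant of two successive convergents is 1 or -1, the vector (q, p) is an
integral combination u (q_n, p_n) + v (q_(n+1), p_(n+1)). If 0 < q < q_(n+1), then u is
not 0, and v is 0 or of the opposite sign. The two errors have opposite signs as well,
so the contributions of u and v do not cancel. *)
Lemma best_approximation alpha n (p q : int) : irrational alpha ->
  0 < q < cf_den alpha n.+1 ->
  cf_dist alpha n <= `|q%:~R * alpha - p%:~R|.
Proof.
move=> ia /andP[q0 qlt].
have D : cf_num alpha n.+1 * cf_den alpha n - cf_num alpha n * cf_den alpha n.+1
  = - (-1) ^+ n.+1 := cf_det (partial_quotient alpha) n.+1.
have d2 : (cf_num alpha n.+1 * cf_den alpha n - cf_num alpha n * cf_den alpha n.+1) ^+ 2
  = 1 by rewrite D sqrrN sqrr_sign.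
have d0 := cf_den_gt0 n ia; have d1 := cf_den_gt0 n.+1 ia.
have E := cf_error_step n ia; rewrite /cf_dist.
have /andP[x0 x1] := @cf_tail_itv R alpha n.+1 ia.
move: (cf_tail alpha n.+1) (cf_num alpha n) (cf_num alpha n.+1) (cf_den alpha n)
  (cf_den alpha n.+1) d2 d0 d1 E x0 x1 qlt => x p0 p1 q0' q1 d2 d0 d1 E x0 x1 qlt {D}.
pose d := p1 * q0' - p0 * q1.
(* Cramer's rule for (q, p) = u (q_n, p_n) + v (q_(n+1), p_(n+1)). *)
pose u := - d * (p * q1 - p1 * q); pose v := - d * (p0 * q - q0' * p).
have qE : u * q0' + v * q1 = q.
  by rewrite /u /v -[RHS]mul1r -d2 /d; ring.
have pE : u * p0 + v * p1 = p.
  by rewrite /u /v -[RHS]mul1r -d2 /d; ring.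
have -> : q%:~R * alpha - p%:~R = (q0'%:~R * alpha - p0%:~R) * (u%:~R - v%:~R * x).
  transitivity (u%:~R * (q0'%:~R * alpha - p0%:~R) + v%:~R * (q1%:~R * alpha - p1%:~R)).
    by rewrite -qE -pE !intrD !intrM; ring.
  by rewrite E; ring.
rewrite normrM ler_peMr//.
case: (lerP v 0) => v0.
  have u1 : 1 <= u.
    rewrite -gtz0_ge1 ltNge; apply/negP => u0; move: q0; rewrite -qE ltNge.
    by clear -v0 u0 d0 d1; nra.
  have u1r : 1 <= u%:~R :> R by rewrite ler1z.
  have v0r : v%:~R <= 0 :> R by rewrite lerz0.
  by rewrite ler_normr; apply/orP; left; nra.
have v1 : 1 <= v by rewrite -gtz0_ge1.
have u1 : u <= -1.
  rewrite -ltzD1 addNr ltNge; apply/negP => u0; move: qlt; rewrite -qE ltNge.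
  by clear -v1 u0 d0 d1; nra.
have u1r : u%:~R <= -1 :> R by rewrite -[-1]/((-1)%:~R) ler_int.
have v1r : 1 <= v%:~R :> R by rewrite ler1z.
by rewrite ler_normr; apply/orP; right; nra.
Qed.
End approximation.

(** * The integral of the approximation function *)

Section integral_of_psi.
Context {R : realType}.
Implicit Types (alpha t : R) (n N : nat).
Local Notation mu := (@lebesgue_measure R).

Lemma inf_eq_min (A : set R) (x : R) : A x -> lbound A x -> inf A = x.
Proof.
move=> Ax lbx; apply/eqP; rewrite eq_le; apply/andP; split.
  by apply: ge_inf => //; exists x.
by apply: lb_le_inf => //; exists x.
Qed.

Lemma dist_int_lb (x : R) (d : R) :
  (forall p : int, d <= `|x - p%:~R|) -> d <= dist_int x.
Proof.
move=> H; apply: lb_le_inf; first by exists `|x - 0%:~R|; exists 0.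
by move=> _ [p _ <-].
Qed.

Lemma dist_int_le (x : R) (p : int) : dist_int x <= `|x - p%:~R|.
Proof.
apply: ge_inf; last by exists p.
by exists 0 => _ [q _ <-].
Qed.

Lemma psiE alpha n t : irrational alpha ->
  (cf_den alpha n)%:~R <= t < (cf_den alpha n.+1)%:~R ->
  psi alpha t = cf_dist alpha n.
Proof.
move=> ia /andP[t0 t1].
have lb (q : nat) : (1 <= q)%N -> q%:R <= t ->
    cf_dist alpha n <= dist_int (q%:R * alpha).
  move=> q1 qt; apply: dist_int_lb => p.
  apply: (@best_approximation _ alpha n p q%:Z) => //.
  rewrite ltz_nat q1 /= -(ltr_int R) (le_lt_trans _ t1)//.
have d0 := cf_den_gt0 n ia.
apply: inf_eq_min; last by move=> _ [q [q1 qt] <-]; exact: lb.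
exists `|cf_den alpha n|%N.
  split; first by rewrite -ltz_nat gtz0_abs.
  by rewrite -[_%:R]/((Posz _)%:~R) gtz0_abs.
have qE : `|cf_den alpha n|%:R = (cf_den alpha n)%:~R :> R.
  by rewrite -[_%:R]/((Posz _)%:~R) gtz0_abs.
apply/eqP; rewrite eq_le; apply/andP; split.
  by rewrite qE; exact: dist_int_le.
apply: lb; last by rewrite qE.
by rewrite -ltz_nat gtz0_abs.
Qed.

Lemma cf_index_exists alpha t : irrational alpha -> 1 <= t ->
  exists N, (cf_den alpha N)%:~R <= t < (cf_den alpha N.+1)%:~R.
Proof.
move=> ia t1.
have [n tn] : exists n, t < (cf_den alpha n)%:~R.
  exists (Num.trunc t).+2; apply: lt_le_trans (truncnS_gt t) _.
  by rewrite -[_%:R]/((Posz _)%:~R) ler_int cf_den_ge.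
elim: n tn => [|n ih] tn; first by move: tn; rewrite ltNge /cf_den /= t1.
by case: (ltP t (cf_den alpha n)%:~R) => [/ih//|tn']; exists n; rewrite tn'.
Qed.

Lemma cf_indexE alpha t N : irrational alpha ->
  (cf_den alpha N)%:~R <= t < (cf_den alpha N.+1)%:~R -> cf_index alpha t = N.
Proof.
move=> ia /andP[N0 N1]; rewrite /cf_index; case: xgetP => [M _|/(_ N)] /=.
  rewrite !convergent_denE// => -[M0 M1].
  have le_of (a b : nat) : (cf_den alpha a)%:~R <= t -> t < (cf_den alpha b.+1)%:~R ->
      (a <= b)%N.
    move=> ta tb; rewrite leqNgt; apply/negP => ba.
    have := cf_den_nondecreasing ia ba; rewrite -(ler_int R) => /(lt_le_trans tb).
    by rewrite ltNge ta.
  by apply/eqP; rewrite eqn_leq !le_of.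
by move=> H; exfalso; apply: H; rewrite !convergent_denE.
Qed.

Lemma psi_ge0 alpha t : irrational alpha -> 1 <= t -> 0 <= psi alpha t.
Proof.
by move=> ia t1; have [N tN] := cf_index_exists ia t1; rewrite (psiE ia tN) normr_ge0.
Qed.

(** Carries measurability along with the value, which makes possible the induction over
the intervals where psi is constant. *)
Lemma integral_extend_cst (f : R -> R) (A B : set R) (s c l : R) :
  measurable A -> measurable B -> [disjoint A & B] ->
  (forall x, (A `|` B) x -> 0 <= f x) -> (forall x, B x -> f x = c) ->
  mu B = l%:E ->
  measurable_fun A f /\ (\int[mu]_(x in A) (f x)%:E = s%:E)%E ->
  measurable_fun (A `|` B) f /\ (\int[mu]_(x in A `|` B) (f x)%:E = (s + c * l)%:E)%E.
Proof.
move=> mA mB dAB f0 fc Bl [mfA intA].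
have mfB : measurable_fun B f.
  apply: (@eq_measurable_fun _ _ _ _ B (cst c)); last exact: measurable_cst.
  by move=> x; rewrite inE => Bx /=; rewrite fc.
have mfU : measurable_fun (A `|` B) f by apply/measurable_funU.
have mfU' := (measurable_realfun.measurable_EFinP _ _).2 mfU.
split=> //; have := ge0_integral_setU mu mA mB mfU' _ dAB.
move=> /(_ (fun x ABx => f0 x ABx)) /= ->.
rewrite intA EFinD; congr (_ + _)%E.
rewrite (eq_integral (cst c%:E)); last by move=> x; rewrite inE => Bx /=; rewrite fc.
by rewrite integral_cst// EFinM -Bl.
Qed.

Lemma integral_psi_den alpha n : irrational alpha ->
  let A : set R := `[1, (cf_den alpha n)%:~R[%classic in
  measurable_fun A (psi alpha) /\
  (\int[mu]_(x in A) (psi alpha x)%:E = (\sum_(i < n) cf_gap alpha i)%:E)%E.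
Proof.
move=> ia A; rewrite {}/A; elim: n => [|n ih].
  rewrite /cf_den /= set_itv_ge ?bnd_simp ?ltxx//.
  by split; [exact: measurable_fun_set0|rewrite integral_set0 big_ord0].
have d1 : 1 <= (cf_den alpha n)%:~R :> R by rewrite ler1z -gtz0_ge1 cf_den_gt0.
have dd : (cf_den alpha n)%:~R <= (cf_den alpha n.+1)%:~R :> R.
  by rewrite ler_int cf_den_nondecreasing.
have -> : `[1, (cf_den alpha n.+1)%:~R[%classic = `[1, (cf_den alpha n)%:~R[ `|`
   `[(cf_den alpha n)%:~R, (cf_den alpha n.+1)%:~R[%classic :> set R.
  by rewrite -itv_bndbnd_setU// bnd_simp.
rewrite big_ord_recr /= cf_gapE// mulrC.
apply: integral_extend_cst => //.
- apply/disj_setPS => x [] /=; rewrite !in_itv /= => /andP[_ h1] /andP[h2 _].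
  by move: h1; rewrite ltNge h2.
- move=> x [] /=; rewrite !in_itv /= => /andP[h _]; apply: psi_ge0 => //.
  exact: le_trans h.
- by move=> x /=; rewrite in_itv /=; exact: psiE.
- rewrite lebesgue_measure_itv /= lte_fin; case: ltP => [_|h]; first by rewrite EFinB.
  by congr EFin; apply/eqP; rewrite eq_sym subr_eq0 eq_le dd h.
Qed.

Lemma I_intE alpha t N : irrational alpha ->
  (cf_den alpha N)%:~R <= t < (cf_den alpha N.+1)%:~R ->
  I_int alpha t = \sum_(i < N) cf_gap alpha i +
    cf_dist alpha N * (t - (cf_den alpha N)%:~R).
Proof.
move=> ia /andP[t0 t1].
have d1 : 1 <= (cf_den alpha N)%:~R :> R by rewrite ler1z -gtz0_ge1 cf_den_gt0.
have H : measurable_fun `[1, t] (psi alpha) /\ 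
  (\int[mu]_(x in `[1%R, t]) (psi alpha x)%:E = (\sum_(i < N) cf_gap alpha i +
    cf_dist alpha N * (t - (cf_den alpha N)%:~R))%:E)%E.
  have -> : `[1, t]%classic = `[1, (cf_den alpha N)%:~R[ `|`
     `[(cf_den alpha N)%:~R, t]%classic :> set R.
    by rewrite -itv_bndbnd_setU// bnd_simp.
  apply: integral_extend_cst (integral_psi_den N ia) => //.
  - apply/disj_setPS => x [] /=; rewrite !in_itv /= => /andP[_ h1] /andP[h2 _].
    by move: h1; rewrite ltNge h2.
  - move=> x [] /=; rewrite !in_itv /= => /andP[h _]; apply: psi_ge0 => //.
    exact: le_trans h.
  - move=> x /=; rewrite in_itv /= => /andP[h1 h2]; apply: psiE => //.
    by rewrite h1 (le_lt_trans h2).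
  - rewrite lebesgue_measure_itv /= lte_fin; case: ltP => [_|h]; first by rewrite EFinB.
    by congr EFin; apply/eqP; rewrite eq_sym subr_eq0 eq_le t0 h.
by rewrite /I_int /Rintegral H.2.
Qed.

(** The part of the integral beyond q_N is at most d_N (q_(N+1) - q_N), which is at most
1. *)
Lemma I_int_bounds alpha t N : irrational alpha ->
  (cf_den alpha N)%:~R <= t < (cf_den alpha N.+1)%:~R ->
  \sum_(i < N) cf_gap alpha i <= I_int alpha t <= \sum_(i < N) cf_gap alpha i + 1.
Proof.
move=> ia tN; rewrite (I_intE ia tN); move: tN => /andP[t0 t1].
have d0 : 0 <= cf_dist alpha N by rewrite normr_ge0.
rewrite lerDl mulr_ge0 ?subr_ge0//= lerD2l -[leRHS](cf_dist_den N ia) ler_wpM2l//.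
have /andP[x0 x1] := @cf_tail_itv R alpha N.+1 ia.
have q0 : 0 < (cf_den alpha N)%:~R :> R by rewrite ltr0z cf_den_gt0.
by have := mulr_ge0 (ltW x0) (ltW q0); lra.
Qed.
End integral_of_psi.

(** * From sequences indexed by convergents to the real parameter *)

Section limits_in_t.
Context {R : realType}.
Implicit Types (alpha t : R) (n N : nat).

Lemma cvg_cf_index alpha : irrational alpha ->
  cf_index alpha t @[t --> +oo] --> \oo.
Proof.
move=> ia A [N _ NA]; exists (cf_den alpha N)%:~R; split; first exact: num_real.
move=> t Nt; apply: NA => /=.
have t1 : 1 <= t.
  by apply: le_trans (ltW Nt); rewrite ler1z -gtz0_ge1 cf_den_gt0.
have [M tM] := cf_index_exists ia t1; rewrite (cf_indexE ia tM).
rewrite leqNgt; apply/negP => MN; move: tM => /andP[_].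
by rewrite ltNge (le_trans _ (ltW Nt))// ler_int cf_den_nondecreasing.
Qed.

Lemma near_cf_index alpha (P : R -> Prop) : irrational alpha ->
  (forall t N, cf_index alpha t = N ->
    (cf_den alpha N)%:~R <= t < (cf_den alpha N.+1)%:~R -> (0 < N)%N -> P t) ->
  \forall t \near +oo, P t.
Proof.
move=> ia H; exists (cf_den alpha 1)%:~R; split; first exact: num_real.
move=> t t1; have t1' : 1 <= t.
  by apply: le_trans (ltW t1); rewrite ler1z -gtz0_ge1 cf_den_gt0.
have [N tN] := cf_index_exists ia t1'; apply: (H t N) => //; first exact: cf_indexE.
by rewrite lt0n; apply/eqP => N0; move: tN; rewrite N0 => /andP[_]; rewrite ltNge ltW.
Qed.

Lemma cvg_I_int_index alpha : irrational alpha ->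
  (\sum_(i < n) cf_gap alpha i) / n%:R @[n --> \oo] --> (1 / 2 : R) ->
  I_int alpha t / (cf_index alpha t)%:R @[t --> +oo] --> (1 / 2 : R).
Proof.
move=> ia H.
have H1 := cvg_comp _ _ (cvg_cf_index ia) H.
have H2' : (\sum_(i < n) cf_gap alpha i) / n%:R + 1 / n%:R @[n --> \oo]
    --> (1 / 2 : R).
  rewrite -[X in _ --> X]addr0; apply: cvgD => //.
  by apply: (@cvg_bounded_div R (fun=> 1) 1) => n; rewrite normr1.
have H2 := cvg_comp _ _ (cvg_cf_index ia) H2'.
apply: squeeze_cvgr H1 H2.
apply: (near_cf_index ia) => t N NE tN N0; have /andP[l u] := I_int_bounds ia tN.
have N0' : 0 < N%:R^-1 :> R by rewrite invr_gt0 ltr0n.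
by rewrite /= NE -mulrDl !ler_pM2r// l u.
Qed.

(** I(t) / ln t is the quotient of I(t) / N and ln t / N, and the latter lies between
ln q_N / N and ln q_(N+1) / N. *)
Lemma cvg_I_int_ln alpha (c : R) : irrational alpha -> c != 0 ->
  I_int alpha t / (cf_index alpha t)%:R @[t --> +oo] --> (1 / 2 : R) ->
  ln (cf_den alpha n)%:~R / n%:R @[n --> \oo] --> c ->
  I_int alpha t / ln t @[t --> +oo] --> 1 / 2 / c.
Proof.
move=> ia c0 HI Hq.
have H1 := cvg_comp _ _ (cvg_cf_index ia) Hq.
have H2' : ln (cf_den alpha n.+1)%:~R / n%:R @[n --> \oo] --> c.
  apply: (@eq_cvgn R (fun n => ln (cf_den alpha n.+1)%:~R / n.+1%:R * (1 + 1 / n%:R)) _ _ 1%N).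
    move=> n n1; rewrite -[n.+1%:R]natr1; have n0 : 0 < n%:R :> R by rewrite ltr0n.
    by field; rewrite !gt_eqF//; lra.
  rewrite -[X in _ --> X]mulr1; apply: cvgM.
    by move: Hq; rewrite -(cvg_shiftS (fun n => ln (cf_den alpha n)%:~R / n%:R)).
  rewrite -[X in _ --> X]addr0; apply: cvgD; first exact: cvg_cst.
  by apply: (@cvg_bounded_div R (fun=> 1) 1) => n; rewrite normr1.
have H2 := cvg_comp _ _ (cvg_cf_index ia) H2'.
have Hln : ln t / (cf_index alpha t)%:R @[t --> +oo] --> c.
  apply: squeeze_cvgr H1 H2.
  apply: (near_cf_index ia) => t N NE /andP[t0 t1] N0.
  have N0' : 0 < N%:R^-1 :> R by rewrite invr_gt0 ltr0n.
  have q0 k : 0 < (cf_den alpha k)%:~R :> R by rewrite ltr0z cf_den_gt0.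
  have tp : 0 < t by apply: lt_le_trans t0; exact: q0.
  by rewrite /= NE !ler_pM2r// !ler_ln ?posrE ?q0// t0 ltW.
have HM : (I_int alpha t / (cf_index alpha t)%:R) *
    (ln t / (cf_index alpha t)%:R)^-1 @[t --> +oo] --> 1 / 2 / c.
  by apply: cvgM => //; exact: cvgV.
apply: cvg_trans HM; apply: near_eq_cvg.
apply: (near_cf_index ia) => t N NE tN N0; rewrite /= NE.
have N0' : N%:R != 0 :> R by rewrite pnatr_eq0 -lt0n.
by rewrite invf_div -mulrA mulKf.
Qed.
End limits_in_t.

(** * Replacing the logarithm of the denominators by a bounded function *)

Section log_martingale.
Context {R : realType}.
Implicit Types (v s : R) (w : seq nat) (alpha : R).

(** Let h v = - ln v + 1 - ln (1 + v) / v. Then U h v = 1 + ln (1 + v), by a telescoping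
series, and this function is h at the new ratio 1 / s minus its mean U h. *)
Definition log_increment w : R :=
  if w is k :: w' then
    let s := k.+1%:R + qratio w' in
    ln s - s * (ln (s + 1) - ln s) - ln (1 + qratio w')
  else 0.

Lemma ln_sqrt s : 0 < s -> ln s = 2 * ln (Num.sqrt s).
Proof.
move=> s0; rewrite -[in LHS](sqr_sqrtr (ltW s0)) lnXn ?sqrtr_gt0//.
by rewrite mulr_natl.
Qed.

Lemma ln_le_sqrt s : 0 < s -> ln s <= 2 * Num.sqrt s.
Proof.
by move=> s0; rewrite ln_sqrt// ler_pM2l// ltW// ln_sublinear// sqrtr_gt0.
Qed.

(** The square root is chosen because the sum of sqrt s / (s (s + 1)) over the digits
converges, and can be compared with a telescoping one. *)
Lemma ln_sqr_le s : 1 <= s -> ln s ^+ 2 <= 16 * Num.sqrt s.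
Proof.
move=> s1; have s0 : 0 < s by lra.
have ss0 : 0 < Num.sqrt s by rewrite sqrtr_gt0.
have L : ln s <= 4 * Num.sqrt (Num.sqrt s).
  by rewrite ln_sqrt//; have := ln_le_sqrt ss0; lra.
rewrite -[X in 16 * X]sqr_sqrtr ?(ltW ss0)//.
have := ln_ge0 s1; have := sqrtr_ge0 (Num.sqrt s); nra.
Qed.

Lemma ln_stepE s : 0 < s -> ln (1 + s^-1) = ln (s + 1) - ln s.
Proof.
move=> s0; rewrite -ln_div ?posrE ?addr_gt0//; congr (ln _).
by field; rewrite gt_eqF.
Qed.

Lemma ln_step s : 0 < s -> ln (s + 1) - ln s <= s^-1.
Proof.
move=> s0; rewrite -ln_stepE//.
by apply: le_ln1Dx; rewrite (lt_trans (ltrN10 R))// invr_gt0.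
Qed.

Lemma log_increment_bounds k w :
  - 2 <= log_increment (k :: w) <= ln (k.+1%:R + qratio w).
Proof.
rewrite /log_increment; set s := k.+1%:R + qratio w.
have v0 : 0 <= qratio w :> R := qratio_ge0 w; have v1 : qratio w <= 1 :> R := qratio_le1 w.
have s1 : 1 <= s by rewrite /s -natr1; have : 0 <= k%:R :> R by []; lra.
have l0 := ln_ge0 s1.
have l1 : ln (1 + qratio w) <= qratio w :> R by apply: le_ln1Dx; lra.
have l2 : 0 <= ln (1 + qratio w) :> R by apply: ln_ge0; lra.
have a1 : s * (ln (s + 1) - ln s) <= 1.
  have := ln_step (lt_le_trans ltr01 s1); rewrite -(ler_pM2l (lt_le_trans ltr01 s1)).
  by rewrite mulfV// gt_eqF//; lra.
have a0 : 0 <= s * (ln (s + 1) - ln s).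
  by apply: mulr_ge0; [lra|rewrite subr_ge0 ler_ln ?posrE; lra].
by apply/andP; split; lra.
Qed.

Lemma log_increment_ge w : - 2 <= log_increment w.
Proof.
by case: w => [|k w]; [rewrite /=; lra|have /andP[] := log_increment_bounds k w].
Qed.

(** With s = k + 1 + v, the quantity sqrt s / (s (s + 1)) is at most
2 (1 / sqrt s - 1 / sqrt (s + 1)), which telescopes. *)
Lemma log_increment_var w N :
  \sum_(k < N) digit_prob (qratio w) k * log_increment ((k : nat) :: w) ^+ 2 <= 68.
Proof.
have v0 : 0 <= qratio w :> R := qratio_ge0 w; have v1 : qratio w <= 1 :> R := qratio_le1 w.
pose s (k : nat) : R := k.+1%:R + qratio w.
have s1 k : 1 <= s k by rewrite /s -natr1; have : 0 <= k%:R :> R by []; lra.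
(* 64 = 16 * 2 * 2: the constant of [ln_sqr_le], the bound 1 + v <= 2, and the factor 2 of
   the telescoping comparison. *)
pose G k := 64 * (Num.sqrt (s k))^-1.
have step (k : nat) : digit_prob (qratio w) k * log_increment ((k : nat) :: w) ^+ 2 <=
    digit_prob (qratio w) k * 4 + (G k - G k.+1).
  have /andP[] := log_increment_bounds k w; rewrite -/(s k).
  move: (log_increment _) => D D0 D1.
  have p0 := digit_prob_gt0 k v0.
  have L0 := ln_ge0 (s1 k); have L2 := ln_sqr_le (s1 k).
  have D2 : D ^+ 2 <= 4 + 16 * Num.sqrt (s k).
    apply: (@le_trans _ _ (4 + ln (s k) ^+ 2)); last by lra.
    move: (ln (s k)) D1 L0 => L D1 L0; rewrite !expr2.
    by case: (lerP 0 D) => d; nra.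
  apply: (@le_trans _ _ (digit_prob (qratio w) k * (4 + 16 * Num.sqrt (s k)))).
    by rewrite ler_pM2l.
  rewrite mulrDr lerD2l /digit_prob.
  have sS : k.+2%:R + qratio w = s k + 1 by rewrite /s -[k.+2%:R]natr1; lra.
  rewrite sS -/(s k) /G.
  have -> : s k.+1 = s k + 1 by rewrite /s -[k.+2%:R]natr1; lra.
  have := s1 k; move: (s k) => x x1.
  have x0 : 0 <= x by lra.
  have x0' : 0 <= x + 1 by lra.
  have ab : Num.sqrt x <= Num.sqrt (x + 1) by rewrite ler_sqrt; lra.
  have a1 : 1 <= Num.sqrt x by rewrite -[leLHS]sqrtr1 ler_sqrt; lra.
  have ax := sqr_sqrtr x0; have bx := sqr_sqrtr x0'.
  move: (Num.sqrt x) (Num.sqrt (x + 1)) ab a1 ax bx => a b ab a1 ax bx.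
  rewrite -bx -ax.
  have -> : (1 + qratio w) / (a ^+ 2 * b ^+ 2) * (16 * a) =
    16 * (1 + qratio w) / (a * b ^+ 2).
    by field; rewrite !gt_eqF//; lra.
  have E : (b - a) * (a + b) = 1 by move: ax bx; nra.
  have -> : 64 / a - 64 / b = 64 / (a * b * (a + b)).
    rewrite -[64 in RHS]mulr1 -[X in _ = 64 * X / _]E.
    by field; rewrite !gt_eqF//; lra.
  rewrite ler_pdivrMr ?mulr_gt0 ?exprn_gt0//; try lra.
  rewrite mulrAC ler_pdivlMr ?mulr_gt0//; try lra.
  have h : 0 <= 4 * b - (1 + qratio w) * (a + b) by nra.
  have ab0 : 0 <= a * b by nra.
  by have := mulr_ge0 ab0 h; lra.
apply: (@le_trans _ _ (\sum_(k < N) (digit_prob (qratio w) k * 4 + (G k - G k.+1)))).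
  by apply: ler_sum => k _; exact: step.
rewrite big_split /= -mulr_suml.
have -> : \sum_(k < N) (G k - G k.+1) = G 0%N - G N.
  rewrite -(big_mkord xpredT (fun k => G k - G k.+1)) -opprB -(telescope_sumr _ (leq0n N)).
  by rewrite -sumrN; apply: eq_bigr => i _; rewrite opprB.
have P1 := sum_digit_prob_le1 N v0.
have GN : 0 <= G N by rewrite mulr_ge0// invr_ge0 sqrtr_ge0.
have G0 : G 0%N <= 64.
  rewrite /G ler_piMr// invf_le1 ?sqrtr_gt0; last by have := s1 0%N; lra.
  by rewrite -[leLHS]sqrtr1 ler_sqrt; have := s1 0%N; lra.
by lra.
Qed.

(** The summand is G s - G (s + 1) with G s = (1 + v) (ln s - ln (1 + v)) / s. *)
Lemma log_increment_mean0 w :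
  series (fun k => digit_prob (qratio w) k * log_increment (k :: w)) @ \oo
    --> (0 : R).
Proof.
have v0 : 0 <= qratio w :> R := qratio_ge0 w; have v1 : qratio w <= 1 :> R := qratio_le1 w.
pose s (k : nat) : R := k.+1%:R + qratio w.
have s1 k : 1 <= s k by rewrite /s -natr1; have : 0 <= k%:R :> R by []; lra.
pose G k := (1 + qratio w) * ((ln (s k) - ln (1 + qratio w)) / s k).
have G0 : G 0%N = 0 by rewrite /G /s subrr mul0r mulr0.
rewrite -[X in _ --> X]subr0 -{1}G0; apply: telescope_series.
  move=> k; rewrite /log_increment /digit_prob /G.
  have sS : k.+2%:R + qratio w = s k + 1 by rewrite /s -[k.+2%:R]natr1; lra.
  have -> : s k.+1 = s k + 1 by rewrite /s -[k.+2%:R]natr1; lra.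
  rewrite sS -/(s k); have := s1 k; move: (s k) => x x1.
  by field; rewrite !gt_eqF//; lra.
rewrite -(mulr0 (1 + qratio w)); apply: cvgMl_tmp.
have cs : (s k)^-1 @[k --> \oo] --> (0 : R) by exact: cvg_inv_shift.
rewrite -[X in _ --> X](subr0 0) -{2}(mulr0 (ln (1 + qratio w))).
under eq_fun do rewrite mulrBl.
apply: cvgB; last exact: cvgMl_tmp.
have cq : 2 * Num.sqrt ((s k)^-1) @[k --> \oo] --> (0 : R).
  rewrite -(mulr0 2) -(@sqrtr0 R); apply: cvgMl_tmp.
  by apply: cvg_comp cs _; exact: sqrt_continuous.
apply: squeeze_cvgr (cvg_cst 0) cq; apply: nearW => k /=.
have sk0 : 0 < s k := lt_le_trans ltr01 (s1 k).
rewrite divr_ge0 ?ln_ge0 ?(ltW sk0)//= ler_pdivrMr//.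
rewrite (sqrtrV (ltW sk0)).
have -> : 2 * (Num.sqrt (s k))^-1 * s k = 2 * Num.sqrt (s k).
  rewrite -[X in _ * X = _](sqr_sqrtr (ltW sk0)); field.
  by rewrite gt_eqF// sqrtr_gt0.
exact: ln_le_sqrt.
Qed.

(** The mean of - ln x over the position of alpha in a cylinder of ratio v. Its averages
are those of - ln V. *)
Definition levy_fun v : R := (1 + v) * ln (1 + v) / v.

(** The logarithms of the inverse ratios sum to ln q_n, and the other terms of
[log_increment] recombine into [levy_fun] with a shift by one index. *)
Lemma sum_log_increment alpha n : irrational alpha ->
  \sum_(i < n) log_increment (cf_word alpha i.+1) =
  ln (cf_den alpha n)%:~R - \sum_(i < n) levy_fun (qratio (cf_word alpha i.+1))
  + ln (1 + qratio (cf_word alpha n)).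
Proof.
move=> ia; elim: n => [|n ih].
  by rewrite !big_ord0 /cf_den /= addr0 ln1 subrr addr0.
have sumS (F : nat -> R) : \sum_(i < n.+1) F i = \sum_(i < n) F i + F n.
  by rewrite big_ord_recr.
rewrite (sumS (fun i => log_increment (cf_word alpha i.+1))).
rewrite (sumS (fun i => levy_fun (qratio (cf_word alpha i.+1)))) {}ih.
have E := qratio_cf_den n ia.
have q0 : 0 < (cf_den alpha n)%:~R :> R by rewrite ltr0z cf_den_gt0.
have q1 : 0 < (cf_den alpha n.+1)%:~R :> R by rewrite ltr0z cf_den_gt0.
rewrite E [cf_word alpha n.+1]/= /log_increment.
rewrite [cf_word alpha n.+1]/= [qratio (_ :: _)]/= in E.
set s : R := _%:R + _ in E *.
have s0 : 0 < s by rewrite -invr_gt0 E divr_gt0.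
have -> : ln (cf_den alpha n.+1)%:~R = ln (cf_den alpha n)%:~R + ln s.
  rewrite -lnM ?posrE// -[s]invrK E; congr (ln _); field; rewrite !gt_eqF//.
rewrite -E /levy_fun invrK.
rewrite ln_stepE//.
have -> : (1 + s^-1) * (ln (s + 1) - ln s) * s = (s + 1) * (ln (s + 1) - ln s).
  by field; rewrite gt_eqF.
by ring.
Qed.

Lemma ln1_qratio_le1 w : `|ln (1 + qratio w) : R| <= 1.
Proof.
have v0 : 0 <= qratio w :> R := qratio_ge0 _.
have v1 : qratio w <= 1 :> R := qratio_le1 _.
have l0 : 0 <= ln (1 + qratio w) :> R by apply: ln_ge0; lra.
rewrite ger0_norm//.
by apply: le_trans v1; apply: le_ln1Dx; lra.
Qed.

Lemma ln_den_levy_fun :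
  {ae @lebesgue_measure R, forall alpha : R, irrational alpha ->
    ln (cf_den alpha n)%:~R / n%:R
    - (\sum_(i < n) levy_fun (qratio (cf_word alpha i.+1))) / n%:R
     @[n --> \oo] --> (0 : R)}.
Proof.
have : {ae @lebesgue_measure R, forall alpha : R, irrational alpha ->
    (\sum_(i < n) log_increment (cf_word alpha i.+1)) / n%:R @[n --> \oo] --> 0}.
  apply: (@martingale_slln R log_increment 68).
  - by move=> w; have := log_increment_ge w; lra.
  - exact: log_increment_mean0.
  - exact: log_increment_var.
apply: negligibleS => alpha; apply: contra_not => Halpha ia.
have {}Halpha := Halpha ia.
apply: (@eq_cvgn R (fun n => (\sum_(i < n) log_increment (cf_word alpha i.+1)) / n%:R
  - ln (1 + qratio (cf_word alpha n)) / n%:R) _ _ 0%N).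
  by move=> n _; rewrite sum_log_increment//; ring.
rewrite -[X in _ --> X]subr0; apply: cvgB; first exact: Halpha.
apply: (@cvg_bounded_div R (fun n => ln (1 + qratio (cf_word alpha n))) 1) => n.
exact: ln1_qratio_le1.
Qed.
End log_martingale.

(** * The transition operator contracts oscillation *)

Section gauss_operator.
Context {R : realType}.
Implicit Types (f : R -> R) (v m M : R).

(** The transition operator of the Markov chain of the ratios. It is also the operator of
the Gauss map for its invariant measure, whence the name. *)
Definition gauss_op f v : R :=
  limn (series (fun k => digit_prob v k * f (k.+1%:R + v)^-1)).

Definition unit_bounded f m M := forall x, 0 < x <= 1 -> m <= f x <= M.

Lemma inv_digit_itv v k : 0 <= v -> 0 < (k.+1%:R + v)^-1 <= 1.
Proof.
move=> v0; rewrite invr_gt0 digit_den_gt0//= invf_le1 ?digit_den_gt0//.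
by rewrite -natr1; have : 0 <= k%:R :> R by []; lra.
Qed.

Lemma cvg_sum_digit_prob v : 0 <= v -> series (digit_prob v) @ \oo --> (1 : R).
Proof.
move=> v0; pose G k := (1 + v) * (k.+1%:R + v)^-1.
have G0 : G 0%N = 1 by rewrite /G mulfV// gt_eqF//; lra.
rewrite -[X in _ --> X]subr0 -{1}G0; apply: telescope_series.
  move=> k; rewrite /digit_prob /G -[k.+2%:R]natr1 -[k.+1%:R]natr1.
  have k0 : 0 <= k%:R :> R by [].
  by field; rewrite !gt_eqF//; lra.
by rewrite -(mulr0 (1 + v)); apply: cvgMl_tmp; exact: cvg_inv_shift.
Qed.

Lemma gauss_op_cvg f M v : 0 <= v -> unit_bounded f 0 M ->
  series (fun k => digit_prob v k * f (k.+1%:R + v)^-1) @ \oo --> gauss_op f v.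
Proof.
move=> v0 fM.
have M0 : 0 <= M.
  have one : 0 < (1 : R) <= 1 by rewrite ltr01 lexx.
  have /andP[a b] := fM 1 one.
  exact: le_trans b.
apply: nondecreasing_is_cvgn.
  apply/nondecreasing_seqP => n; rewrite /series /= big_nat_recr//= lerDl.
  rewrite mulr_ge0 ?(ltW (digit_prob_gt0 _ v0))//.
  by have /andP[] := fM _ (inv_digit_itv n v0).
exists M => _ [n _ <-]; rewrite seriesEord /=.
apply: (@le_trans _ _ (\sum_(k < n) digit_prob v k * M)).
  apply: ler_sum => k _; rewrite ler_pM2l ?digit_prob_gt0//.
  by have /andP[] := fM _ (inv_digit_itv k v0).
by rewrite -mulr_suml ler_piMl// sum_digit_prob_le1.
Qed.

Lemma gauss_op_bounds f m M v : 0 <= v -> unit_bounded f 0 M ->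
  unit_bounded f m M -> m <= gauss_op f v <= M.
Proof.
move=> v0 f0M fmM; have fc := gauss_op_cvg v0 f0M.
have pc := cvg_sum_digit_prob v0.
have cm (b : R) : b * series (digit_prob v) n @[n --> \oo] --> b.
  by rewrite -[X in _ --> X]mulr1; exact: cvgMl_tmp.
apply/andP; split.
- apply: (ler_cvg_to (cm m) fc); apply: nearW => n.
  rewrite !seriesEord mulr_sumr; apply: ler_sum => k _; rewrite mulrC ler_pM2l ?digit_prob_gt0//.
  by have /andP[] := fmM _ (inv_digit_itv k v0).
- apply: (ler_cvg_to fc (cm M)); apply: nearW => n.
  rewrite !seriesEord mulr_sumr; apply: ler_sum => k _; rewrite [leRHS]mulrC ler_pM2l ?digit_prob_gt0//.
  by have /andP[] := fmM _ (inv_digit_itv k v0).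
Qed.

Lemma gauss_op_compl f M v : 0 <= v -> unit_bounded f 0 M ->
  gauss_op (fun x => M - f x) v = M - gauss_op f v.
Proof.
move=> v0 fM; apply/cvg_lim => //.
have -> : series (fun k => digit_prob v k * (M - f (k.+1%:R + v)^-1)) =
  (fun n => M * series (digit_prob v) n -
     series (fun k => digit_prob v k * f (k.+1%:R + v)^-1) n).
  apply/funext => n; rewrite !seriesEord mulr_sumr -sumrB.
  by apply: eq_bigr => k _; ring.
apply: cvgB; last exact: gauss_op_cvg fM.
by rewrite -[X in _ --> X]mulr1; apply: cvgMl_tmp; exact: cvg_sum_digit_prob.
Qed.

Definition unit_nondecreasing f := forall x y, 0 < x -> x <= y -> y <= 1 -> f x <= f y.

Lemma abel_sum (p F : nat -> R) n :
  \sum_(k < n.+1) p k * F k =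
  (\sum_(k < n.+1) p k) * F n +
  \sum_(k < n) (\sum_(j < k.+1) p j) * (F k - F k.+1).
Proof.
have sumS (G : nat -> R) (j : nat) : \sum_(i < j.+1) G i = \sum_(i < j) G i + G j.
  by rewrite big_ord_recr.
elim: n => [|n ih]; first by rewrite !big_ord_recr !big_ord0 /=; ring.
rewrite [LHS](sumS (fun k => p k * F k)) ih (sumS p n.+1).
rewrite [X in _ = _ + X](sumS (fun k => (\sum_(j < k.+1) p j) * (F k - F k.+1))).
by ring.
Qed.

(** If v grows then 1 / (k + 1 + v) decreases for each k, and the distribution
[digit_prob] moves towards larger k, for which this number is smaller. The second
effect is made visible by Abel summation. *)
Lemma gauss_op_antitone f M v v' : unit_bounded f 0 M -> unit_nondecreasing f ->
  0 <= v -> v <= v' -> gauss_op f v' <= gauss_op f v.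
Proof.
move=> fM fmono v0 vv'; have v'0 : 0 <= v' := le_trans v0 vv'.
apply: (ler_cvg_to (gauss_op_cvg v'0 fM) (gauss_op_cvg v0 fM)).
apply: nearW => -[|n]; first by rewrite !seriesEord /= !big_ord0.
rewrite !seriesEord /=.
pose F (k : nat) := f (k.+1%:R + v)^-1.
have itv (k : nat) := inv_digit_itv k v0; have itv' (k : nat) := inv_digit_itv k v'0.
apply: (@le_trans _ _ (\sum_(k < n.+1) digit_prob v' k * F k)).
  apply: ler_sum => k _; rewrite ler_pM2l ?digit_prob_gt0//.
  have /andP[a b] := itv k; have /andP[a' b'] := itv' k.
  by apply: fmono => //; rewrite lef_pV2 ?posrE ?digit_den_gt0// lerD2l.
rewrite (abel_sum (digit_prob v') F) (abel_sum (digit_prob v) F).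
have Ple k : \sum_(j < k.+1) digit_prob v' j <= \sum_(j < k.+1) digit_prob v j.
  rewrite !sum_digit_prob//; apply: ler_wpM2l => //.
  by rewrite lef_pV2 ?posrE ?digit_den_gt0// lerD2l.
apply: lerD.
  by apply: ler_wpM2r => //; have /andP[] := fM _ (itv n).
apply: ler_sum => k _; apply: ler_wpM2r => //; rewrite subr_ge0.
have /andP[a b] := itv k; have /andP[a' b'] := itv k.+1.
by apply: fmono => //; rewrite lef_pV2 ?posrE ?digit_den_gt0// lerD2r ler_nat.
Qed.

(** The distribution of the digits for v = 0 is 1/2 on the first digit, and otherwise half
the distribution for v = 1 with the digits shifted by one. This identity is the source
of the contraction. *)
Lemma gauss_op_at0 f M : unit_bounded f 0 M ->
  gauss_op f 0 = (f 1 + gauss_op f 1) / 2.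
Proof.
move=> fM; have c0 := gauss_op_cvg (lexx 0) fM; have c1 := gauss_op_cvg ler01 fM.
have {}c0 : (f 1 + series (fun k => digit_prob 1 k * f (k.+1%:R + 1)^-1) n) / 2
    @[n --> \oo] --> gauss_op f 0.
  move: c0; rewrite -(cvg_shiftS (series _)); apply: cvg_trans.
  apply: near_eq_cvg; apply: nearW => n.
  rewrite !seriesEord /= big_ord_recl /= mulrDl mulr_suml; congr (_ + _).
    by rewrite /digit_prob !addr0 invr1; field.
  apply: eq_bigr => k _; rewrite /bump /= add1n addr0 /digit_prob !addr0.
  rewrite !natr1.
  set F := f _; rewrite -[k.+3%:R]natr1 -[k.+2%:R]natr1 -[k.+1%:R]natr1.
  have k0 : 0 <= k%:R :> R by [].
  by field; rewrite !gt_eqF//; lra.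
rewrite -(cvg_lim _ c0)//; apply/cvg_lim => //.
by apply: cvgMr_tmp; apply: cvgD => //; exact: cvg_cst.
Qed.

(** Applying the operator twice preserves monotonicity instead of reversing it. *)
Definition gauss_op2 f v := gauss_op (gauss_op f) v.

Lemma unit_bounded_gauss_op f M : unit_bounded f 0 M -> unit_bounded (gauss_op f) 0 M.
Proof. by move=> fM x /andP[x0 _]; apply: gauss_op_bounds => //; exact: ltW. Qed.

Lemma unit_bounded_compl f M : unit_bounded f 0 M ->
  unit_bounded (fun x => M - f x) 0 M.
Proof. by move=> fM x x01; have /andP[a b] := fM x x01; apply/andP; split; lra. Qed.

Lemma gauss_op2_monotone f M v v' : unit_bounded f 0 M -> unit_nondecreasing f ->
  0 <= v -> v <= v' -> gauss_op2 f v <= gauss_op2 f v'.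
Proof.
move=> fM fmono v0 vv'.
have UM := unit_bounded_gauss_op fM.
have cmono : unit_nondecreasing (fun x => M - gauss_op f x).
  move=> x y x0 xy _; rewrite lerD2l lerN2.
  by apply: gauss_op_antitone fM fmono _ xy; exact: ltW.
have := gauss_op_antitone (unit_bounded_compl UM) cmono v0 vv'.
rewrite !(gauss_op_compl _ UM) ?(le_trans v0)//.
by rewrite /gauss_op2; lra.
Qed.

(** Each application divides the oscillation by 2: by [gauss_op_at0], U f 0 - U f 1 is half
of f 1 - U f 1. For the second application this is used at U f 1 and at the upper
bound U f 0 of U f. *)
Lemma gauss_op2_osc f m M : unit_bounded f 0 M -> unit_nondecreasing f ->
  unit_bounded f m M ->
  gauss_op2 f 1 - gauss_op2 f 0 <= (f 1 - m) / 4.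
Proof.
move=> fM fmono fmM.
have UM := unit_bounded_gauss_op fM.
have E0 := gauss_op_at0 fM; have E1 := gauss_op_at0 UM.
have /andP[m1 _] := gauss_op_bounds ler01 fM fmM.
have /andP[_ U1] : gauss_op f 1 <= gauss_op (gauss_op f) 1 <= gauss_op f 0.
  have UM' : unit_bounded (gauss_op f) (gauss_op f 1) (gauss_op f 0).
    move=> x /andP[x0 x1]; apply/andP; split.
      exact: gauss_op_antitone fM fmono (ltW x0) x1.
    exact: gauss_op_antitone fM fmono (lexx 0) (ltW x0).
  have UM0 : unit_bounded (gauss_op f) 0 (gauss_op f 0).
    by move=> x x01; have /andP[_ ->] := UM' x x01; have /andP[-> _] := UM x x01.
  exact: gauss_op_bounds UM0 UM'.
by rewrite /gauss_op2 E1; lra.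
Qed.

Definition gauss_iter f L : R -> R := iter L gauss_op2 f.

Lemma gauss_iter_class f M L : unit_bounded f 0 M -> unit_nondecreasing f ->
  unit_bounded (gauss_iter f L) 0 M /\ unit_nondecreasing (gauss_iter f L).
Proof.
move=> fM fmono; elim: L => [//|L [ih1 ih2]] /=; split.
  by do 2 apply: unit_bounded_gauss_op.
by move=> x y x0 xy _; apply: gauss_op2_monotone ih1 ih2 _ xy; exact: ltW.
Qed.

Lemma gauss_iter_osc f M L : unit_bounded f 0 M -> unit_nondecreasing f ->
  exists m, unit_bounded (gauss_iter f L) m (m + M / 4 ^+ L).
Proof.
move=> fM fmono; elim: L => [|L [m mE]] /=.
  by exists 0; rewrite expr0 divr1 add0r.
have [ih1 ih2] := gauss_iter_class L fM fmono.
have one : 0 < (1 : R) <= 1 by rewrite ltr01 lexx.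
have mM : unit_bounded (gauss_iter f L) m M.
  by move=> x x01; have /andP[-> _] := mE x x01; have /andP[_ ->] := ih1 x x01.
have osc := gauss_op2_osc ih1 ih2 mM.
have /andP[_ top] := mE 1 one.
exists (gauss_op2 (gauss_iter f L) 0) => x /andP[x0 x1].
rewrite (gauss_op2_monotone ih1 ih2 (lexx 0) (ltW x0)) /=.
apply: (le_trans (gauss_op2_monotone ih1 ih2 (ltW x0) x1)).
have E : M / 4 ^+ L.+1 = M / 4 ^+ L / 4.
  by rewrite exprS; field; rewrite expf_neq0// pnatr_eq0.
by rewrite E; lra.
Qed.
End gauss_operator.

(** * Averages along the digits of almost every number *)

Section averages.
Context {R : realType}.
Implicit Types (f : R -> R) (m M c : R) (alpha : R).

Definition avg f alpha n : R :=
  (\sum_(i < n) f (qratio (cf_word alpha i.+1))) / n%:R.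

Definition op_increment f w : R :=
  if w is k :: w' then f (qratio w) - gauss_op f (qratio w') else 0.

Lemma unit_bounded_ge0 f M : unit_bounded f 0 M -> 0 <= M.
Proof.
move=> fM; have one : 0 < (1 : R) <= 1 by rewrite ltr01 lexx.
by have /andP[a b] := fM 1 one; exact: le_trans b.
Qed.

Lemma op_increment_le f M w : unit_bounded f 0 M -> `|op_increment f w| <= M.
Proof.
move=> fM; have M0 := unit_bounded_ge0 fM.
case: w => [|k w]; first by rewrite normr0.
have /andP[a b] := fM _ (inv_digit_itv k (qratio_ge0 w)).
have /andP[a' b'] := gauss_op_bounds (qratio_ge0 w) fM fM.
by rewrite /= ler_norml; apply/andP; split; lra.
Qed.

Lemma op_increment_mean0 f M w : unit_bounded f 0 M ->
  series (fun k => digit_prob (qratio w) k * op_increment f (k :: w)) @ \oo --> 0.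
Proof.
move=> fM; have v0 : 0 <= qratio w :> R := qratio_ge0 w.
set v := qratio w in v0 *; pose b := gauss_op f v.
have -> : series (fun k => digit_prob v k * op_increment f (k :: w)) =
  (fun n => series (fun k => digit_prob v k * f (k.+1%:R + v)^-1) n -
     b * series (digit_prob v) n).
  apply/funext => n; rewrite !seriesEord /= mulr_sumr -sumrB.
  by apply: eq_bigr => k _; rewrite -/v -/b; ring.
rewrite -(subrr b); apply: cvgB; first exact: gauss_op_cvg fM.
by rewrite -[X in _ --> X]mulr1; apply: cvgMl_tmp; exact: cvg_sum_digit_prob.
Qed.

Lemma sum_op_increment f alpha n :
  \sum_(i < n) op_increment f (cf_word alpha i.+1) =
  \sum_(i < n) f (qratio (cf_word alpha i.+1)) -
  \sum_(i < n) gauss_op f (qratio (cf_word alpha i.+1)) +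
  gauss_op f (qratio (cf_word alpha n)) - gauss_op f 0.
Proof.
elim: n => [|n ih]; first by rewrite !big_ord0 subrr add0r subrr.
have sumS (F : nat -> R) : \sum_(i < n.+1) F i = \sum_(i < n) F i + F n.
  by rewrite big_ord_recr.
rewrite (sumS (fun i => op_increment f (cf_word alpha i.+1))).
rewrite (sumS (fun i => f (qratio (cf_word alpha i.+1)))).
rewrite (sumS (fun i => gauss_op f (qratio (cf_word alpha i.+1)))) {}ih.
rewrite [op_increment f _]/= -/(cf_word alpha n.+1).
rewrite -[(_ + _)^-1]/(qratio (cf_word alpha n.+1)).
move: (gauss_op f 0) (gauss_op f (qratio (cf_word alpha n))) => a b.
move: (gauss_op f (qratio (cf_word alpha n.+1))) (f (qratio (cf_word alpha n.+1))).
by move=> c d; ring.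
Qed.

(** Up to a boundary term, the difference of the two averages is the average of
[op_increment], which has mean 0 over children, so that [martingale_slln] applies. *)
Lemma avg_gauss_op f M : unit_bounded f 0 M ->
  {ae @lebesgue_measure R, forall alpha : R, irrational alpha ->
    avg f alpha n - avg (gauss_op f) alpha n @[n --> \oo] --> (0 : R)}.
Proof.
move=> fM; have M0 := unit_bounded_ge0 fM.
have : {ae @lebesgue_measure R, forall alpha : R, irrational alpha ->
    (\sum_(i < n) op_increment f (cf_word alpha i.+1)) / n%:R @[n --> \oo] --> 0}.
  apply: (@martingale_slln R (op_increment f) (M + M ^+ 2)).
  - move=> w; have := op_increment_le w fM; rewrite ler_norml => /andP[+ _].
    by have := sqr_ge0 M; lra.
  - by move=> w; exact: op_increment_mean0 fM.
  - move=> w N; apply: (@le_trans _ _ (\sum_(k < N) digit_prob (qratio w) k * M ^+ 2)).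
      apply: ler_sum => k _; rewrite ler_wpM2l ?(ltW (digit_prob_gt0 _ (qratio_ge0 _)))//.
      rewrite -[leLHS]real_normK ?num_real//.
      by rewrite ler_sqr ?nnegrE// op_increment_le.
    rewrite -mulr_suml; apply: (@le_trans _ _ (M ^+ 2)); last by rewrite lerDr.
    by rewrite ler_piMl ?sqr_ge0//; apply: sum_digit_prob_le1; exact: qratio_ge0.
apply: negligibleS => alpha; apply: contra_not => Halpha ia.
have {}Halpha := Halpha ia.
pose E n : R := gauss_op f (qratio (cf_word alpha n)) - gauss_op f 0.
apply: (@eq_cvgn R (fun n => (\sum_(i < n) op_increment f (cf_word alpha i.+1)) / n%:R
  - E n / n%:R) _ _ 0%N).
  move=> n _; rewrite sum_op_increment -/(E n) /avg /E.
  move: (gauss_op f 0) (gauss_op f (qratio (cf_word alpha n))) => a b; ring.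
rewrite -[X in _ --> X]subr0; apply: cvgB; first exact: Halpha.
apply: (@cvg_bounded_div R E M) => n; rewrite /E.
have /andP[a b] := gauss_op_bounds (qratio_ge0 (cf_word alpha n)) fM fM.
have /andP[a' b'] := gauss_op_bounds (lexx 0) fM fM.
by rewrite ler_norml; apply/andP; split; lra.
Qed.

Lemma avg_gauss_iter f M : unit_bounded f 0 M -> unit_nondecreasing f ->
  {ae @lebesgue_measure R, forall alpha : R, forall L, irrational alpha ->
    avg f alpha n - avg (gauss_iter f L) alpha n @[n --> \oo] --> (0 : R)}.
Proof.
move=> fM fmono; apply: ae_foralln; elim => [|L ih].
  apply: (@negligibleS _ _ _ _ set0); last exact: negligible_set0.
  move=> alpha; apply; move=> _ /=.
  by under eq_fun do rewrite subrr; exact: cvg_cst.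
have [LM _] := gauss_iter_class L fM fmono.
have h1 := avg_gauss_op LM.
have h2 := avg_gauss_op (unit_bounded_gauss_op LM).
apply: negligibleS (negligibleU ih (negligibleU h1 h2)).
move=> alpha /= Hneg; apply: contrapT => /not_orP[/contrapT k0 /not_orP[/contrapT k1 /contrapT k2]].
apply: Hneg => ia; have {}k0 := k0 ia; have {}k1 := k1 ia; have {}k2 := k2 ia.
apply: (@eq_cvgn R (fun n => (avg f alpha n - avg (gauss_iter f L) alpha n) +
  ((avg (gauss_iter f L) alpha n - avg (gauss_op (gauss_iter f L)) alpha n) +
   (avg (gauss_op (gauss_iter f L)) alpha n -
    avg (gauss_op (gauss_op (gauss_iter f L))) alpha n))) _ _ 0%N).
  by move=> n _; rewrite /= /gauss_op2 addrA subrKA subrKA.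
rewrite -[X in _ --> X]addr0; apply: cvgD; first exact: k0.
by rewrite -[X in _ --> X]addr0; apply: cvgD; [exact: k1|exact: k2].
Qed.

(** By [avg_gauss_iter], replacing f by its iterates does not change the limit of the
averages, and the iterates are eventually within any distance of [c]. *)
Lemma avg_cvg f M c : unit_bounded f 0 M -> unit_nondecreasing f ->
  (forall L m, unit_bounded (gauss_iter f L) m (m + M / 4 ^+ L) ->
    m <= c <= m + M / 4 ^+ L) ->
  {ae @lebesgue_measure R, forall alpha : R, irrational alpha ->
    avg f alpha n @[n --> \oo] --> c}.
Proof.
move=> fM fmono Hc; have M0 := unit_bounded_ge0 fM.
apply: negligibleS (avg_gauss_iter fM fmono) => alpha.
apply: contra_not => Halpha ia.
apply/cvgrPdist_le => e e0.
have e2 : 0 < e / 2 by rewrite divr_gt0.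
have [L Le] : exists L, M / 4 ^+ L <= e / 2.
  exists (Num.trunc (M / (e / 2))).+1; rewrite ler_pdivrMr ?exprn_gt0// mulrC -ler_pdivrMr//.
  apply: (le_trans (ltW (truncnS_gt _))); rewrite -natrX ler_nat.
  by apply: ltnW; apply: ltn_expl.
have [m mE] := gauss_iter_osc L fM fmono.
have /andP[c1 c2] := Hc L m mE.
have /cvgr0Pnorm_le /(_ _ e2) [N _ HN] := Halpha L ia.
exists (maxn N 1) => // n /=; rewrite geq_max => /andP[Nn n1].
have n0 : 0 < n%:R :> R by rewrite ltr0n.
have := HN n Nn; rewrite /= ler_norml => /andP[h1 h2].
have bnd (i : nat) : m <= gauss_iter f L (qratio (cf_word alpha i.+1)) <= m + M / 4 ^+ L.
  by apply: mE; exact: inv_digit_itv (qratio_ge0 _).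
have a1 : m <= avg (gauss_iter f L) alpha n.
  rewrite /avg ler_pdivlMr// mulr_natr -[X in _ *+ X]card_ord -sumr_const.
  by apply: ler_sum => i _; have /andP[] := bnd i.
have a2 : avg (gauss_iter f L) alpha n <= m + M / 4 ^+ L.
  rewrite /avg ler_pdivrMr// mulr_natr -[X in _ *+ X]card_ord -sumr_const.
  by apply: ler_sum => i _; have /andP[] := bnd i.
by rewrite ler_norml; apply/andP; split; lra.
Qed.
End averages.

(** * Lattice sums are invariant under the transition operator *)

Section lattice_sums.
Context {R : realType}.
Implicit Types (f : R -> R) (M : R) (a b c k X : nat).

Definition pair_weight f b c : R :=
  f (b%:R / c%:R) / (c%:R * (b%:R + c%:R)).

(** The sum of f (b / c) / (c (b + c)) over the pairs 1 <= b <= c <= X, coprime or not.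
Divided by its value for f = 1, it tends to the mean of f for the invariant measure
dv / (1 + v). *)
Definition lattice_sum f X : R :=
  \sum_(c < X) \sum_(b < c.+1) pair_weight f b.+1 c.+1.

Lemma frac_itv a b : (a <= b)%N -> (0 : R) < (a.+1%:R / b.+1%:R : R) <= 1.
Proof.
move=> ab; rewrite divr_gt0//= ler_pdivrMr// mul1r ler_nat ltnS//.
Qed.

Lemma pair_weight_bounds f M b c : unit_bounded f 0 M -> (b <= c)%N ->
  0 <= pair_weight f b.+1 c.+1 <= M / (c.+1%:R * (b.+1%:R + c.+1%:R)).
Proof.
move=> fM bc; have /andP[f0 f1] := fM _ (frac_itv bc).
have d0 : 0 < c.+1%:R * (b.+1%:R + c.+1%:R) :> R by rewrite mulr_gt0 ?addr_gt0.
by rewrite divr_ge0 ?(ltW d0)//= ler_pM2r ?invr_gt0.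
Qed.

(** The step from (a, b) to (b, (k + 1) b + a) multiplies weights exactly by the transition
probability. This is the reason for the weight 1 / (b (a + b)). *)
Lemma digit_prob_weight f a b k :
  digit_prob (a.+1%:R / b.+1%:R) k * f (k.+1%:R + a.+1%:R / b.+1%:R)^-1
   / (b.+1%:R * (a.+1%:R + b.+1%:R)) =
  pair_weight f b.+1 (k.+1 * b.+1 + a.+1).
Proof.
have a0 : 0 <= a%:R :> R by []. have b0 : 0 <= b%:R :> R by [].
have k0 : 0 <= k%:R :> R by [].
have -> : (k.+1%:R + a.+1%:R / b.+1%:R)^-1 = b.+1%:R / (k.+1 * b.+1 + a.+1)%:R :> R.
  rewrite natrD natrM -[k.+1%:R]natr1 -[a.+1%:R]natr1 -[b.+1%:R]natr1.
  by field; rewrite !gt_eqF//; nra.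
rewrite /pair_weight; move: (f _) => F.
rewrite /digit_prob natrD natrM -[k.+2%:R]natr1 -[k.+1%:R]natr1 -[a.+1%:R]natr1 -[b.+1%:R]natr1.
by field; rewrite !gt_eqF//; nra.
Qed.

(** The digits from [X] on have total probability (1 + v) / (X + 1 + v). *)
Lemma pair_weight_op_bounds f M a b X : unit_bounded f 0 M -> (0 < X)%N ->
  0 <= pair_weight (gauss_op f) a.+1 b.+1 -
    \sum_(k < X) pair_weight f b.+1 (k.+1 * b.+1 + a.+1)
  <= M / (b.+1%:R * X%:R).
Proof.
move=> fM X0; rewrite subr_ge0 lerBlDl; have M0 := unit_bounded_ge0 fM.
pose v : R := a.+1%:R / b.+1%:R; have v0 : 0 <= v by rewrite divr_ge0.
pose d : R := b.+1%:R * (a.+1%:R + b.+1%:R).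
have d0 : 0 < d by rewrite mulr_gt0 ?addr_gt0.
have cU := gauss_op_cvg v0 fM.
have x0 : 0 < X%:R :> R by rewrite ltr0n.
pose s := series (fun k => digit_prob v k * f (k.+1%:R + v)^-1).
have SE n : \sum_(k < n) pair_weight f b.+1 (k.+1 * b.+1 + a.+1) = s n / d.
  rewrite /s seriesEord /= mulr_suml; apply: eq_bigr => k _.
  by rewrite -digit_prob_weight.
have fk (k : nat) : 0 <= f (k.+1%:R + v)^-1 <= M by apply: fM; exact: inv_digit_itv.
have p0 (k : nat) : 0 <= digit_prob v k by rewrite ltW// digit_prob_gt0.
have -> : pair_weight (gauss_op f) a.+1 b.+1 = gauss_op f v / d by [].
rewrite SE.
have step n : s X <= s (X + n)%N <= s X + M * (\sum_(k < X + n) digit_prob v k - \sum_(k < X) digit_prob v k).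
  rewrite /s !seriesEord /= !big_split_ord /= [X in _ * X]addrAC subrr add0r.
  rewrite lerDl lerD2l mulr_sumr; apply/andP; split.
    by apply: sumr_ge0 => k _; rewrite mulr_ge0//; have /andP[] := fk (X + k)%N.
  by apply: ler_sum => k _; rewrite [leRHS]mulrC ler_wpM2l//; have /andP[] := fk (X + k)%N.
apply/andP; split.
  rewrite ler_pM2r ?invr_gt0//; apply: (@le_cvgn R s _ _ X) => // n Xn.
  by rewrite -(subnKC Xn); have /andP[] := step (n - X)%N.
have gen (S B Y D : R) : 0 < B -> 0 < Y -> 0 < D ->
    S / D + M / (B * Y) = (S + M * (D / (B * Y))) / D.
  by move=> B0 Y0 D0; field; rewrite !gt_eqF.
rewrite gen//.
rewrite ler_pM2r ?invr_gt0//; apply: (@ge_cvgn R s _ _ X) => // n Xn.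
rewrite -(subnKC Xn); have /andP[_] := step (n - X)%N; move/le_trans; apply.
rewrite lerD2l; apply: ler_wpM2l => //.
apply: (@le_trans _ _ (1 - \sum_(k < X) digit_prob v k)).
  by rewrite lerD2r sum_digit_prob_le1.
rewrite sum_digit_prob// /v /d.
have a0 : 0 <= a%:R :> R by []. have b0 : 0 <= b%:R :> R by [].
have -> : 1 - X%:R / (X.+1%:R + a.+1%:R / b.+1%:R) =
   (a.+1%:R + b.+1%:R) / (X.+1%:R * b.+1%:R + a.+1%:R) :> R.
  rewrite -[X.+1%:R]natr1 -[a.+1%:R]natr1 -[b.+1%:R]natr1.
  by field; rewrite !gt_eqF//; nra.
have -> : b.+1%:R * (a.+1%:R + b.+1%:R) / (b.+1%:R * X%:R) = (a.+1%:R + b.+1%:R) / X%:R :> R.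
  by rewrite -mulf_div divff ?mul1r.
apply: ler_wpM2l; first by rewrite addr_ge0.
have D0 : 0 < X.+1%:R * b.+1%:R + a.+1%:R :> R by rewrite addr_gt0 ?mulr_gt0.
rewrite lef_pV2 ?posrE//.
rewrite -[X.+1%:R]natr1 -[a.+1%:R]natr1 -[b.+1%:R]natr1.
by have := mulr_ge0 (ltW x0) b0; lra.
Qed.

Lemma sum_blocks (G : nat -> R) b X :
  \sum_(i < X * b) G i = \sum_(k < X) \sum_(a < b) G (k * b + a)%N.
Proof.
elim: X => [|X ih]; first by rewrite !big_ord0.
rewrite big_ord_recr /= -ih mulSnr big_split_ord /=.
by congr (_ + _); apply: eq_bigr.
Qed.

Lemma sum_triangle (F : nat -> nat -> R) X :
  \sum_(b < X) \sum_(i < X - b.+1) F b.+1 (b.+1 + i.+1)%N =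
  \sum_(c < X) \sum_(b < c) F b.+1 c.+1.
Proof.
elim: X => [|X ih]; first by rewrite !big_ord0.
rewrite big_ord_recr [in RHS]big_ord_recr /= -ih subnn big_ord0 addr0 -big_split /=.
apply: eq_bigr => b _; rewrite subSn ?ltn_ord// big_ord_recr /=; congr (_ + F _ _).
by rewrite addnS subnKC// ltn_ord.
Qed.

Lemma tail_inv_sqr X b n : (0 < X)%N ->
  \sum_(j < n) ((X + j).+1%:R * (b%:R + (X + j).+1%:R))^-1 <= X%:R^-1 :> R.
Proof.
move=> X0; have x0 : 0 < X%:R :> R by rewrite ltr0n.
suff : \sum_(j < n) ((X + j).+1%:R * (b%:R + (X + j).+1%:R))^-1 <=
    X%:R^-1 - (X + n)%:R^-1 :> R.
  by move/le_trans; apply; rewrite gerBl invr_ge0.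
elim: n => [|n ih]; first by rewrite big_ord0 addn0 subrr.
rewrite big_ord_recr /=; apply: (le_trans (lerD ih (lexx _))).
rewrite addnS -[(X + n).+1%:R]natr1.
have y0 : 0 < (X + n)%:R :> R by rewrite ltr0n addn_gt0 X0.
have b0 : 0 <= b%:R :> R by [].
move: ((X + n)%:R) (X%:R^-1) y0 (b%:R) b0 => y x y0 B B0.
rewrite -addrA lerD2l.
have -> : - (y + 1)^-1 = - y^-1 + (y * (y + 1))^-1.
  by field; rewrite !gt_eqF//; lra.
rewrite lerD2l lef_pV2 ?posrE; last 2 first.
- by apply: mulr_gt0; lra.
- by apply: mulr_gt0; lra.
by rewrite mulrC; apply: ler_pM; lra.
Qed.

(** When a runs over 1, ..., b and k over 1, ..., X, the number k b + a runs exactly once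
over b + 1, ..., (X + 1) b. The pairs with second entry above X have total weight at
most M / X, and so does the rest of the series defining the operator. *)
Lemma row_sum_op_bounds f M b X : unit_bounded f 0 M -> (b < X)%N ->
  0 <= \sum_(a < b.+1) pair_weight (gauss_op f) a.+1 b.+1 -
    \sum_(i < X - b.+1) pair_weight f b.+1 (b.+1 + i.+1)
  <= 2 * M / X%:R.
Proof.
move=> fM bX; have X0 : (0 < X)%N := leq_trans (ltn0Sn b) bX.
have M0 := unit_bounded_ge0 fM.
have x0 : 0 < X%:R :> R by rewrite ltr0n.
pose G i := pair_weight f b.+1 (b.+1 + i.+1).
pose full := \sum_(i < X * b.+1) G i.
have fullE : full = \sum_(a < b.+1) \sum_(k < X)
    pair_weight f b.+1 (k.+1 * b.+1 + a.+1).
  rewrite /full sum_blocks exchange_big /=; apply: eq_bigr => a _.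
  by apply: eq_bigr => k _; rewrite /G; congr pair_weight; rewrite mulSn !addnS addnA.
have split1 : 0 <= \sum_(a < b.+1) pair_weight (gauss_op f) a.+1 b.+1 - full <= M / X%:R.
  rewrite fullE -sumrB; apply/andP; split.
    by apply: sumr_ge0 => a _; have /andP[] := pair_weight_op_bounds a b fM X0.
  apply: (@le_trans _ _ (\sum_(a < b.+1) M / (b.+1%:R * X%:R))).
    by apply: ler_sum => a _; have /andP[] := pair_weight_op_bounds a b fM X0.
  rewrite sumr_const card_ord -[leLHS]mulr_natr.
  have gen (A B : R) : B != 0 -> M / (B * A) * B = M / A.
    by move=> B0; rewrite invfM [B^-1 * _]mulrC mulrA mulfVK.
  by rewrite gen ?pnatr_eq0.
have leX : (X - b.+1 <= X * b.+1)%N.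
  by rewrite (leq_trans (leq_subr _ _))// leq_pmulr.
have G0 i : 0 <= G i.
  rewrite /G addnS.
  by have /andP[] := pair_weight_bounds (c := (b.+1 + i)%N) (b := b) fM (leq_trans (leqnSn b) (leq_addr _ _)).
(* The full block reaches beyond X since X - b <= X b. *)
have split2 : 0 <= full - \sum_(i < X - b.+1) G i <= M / X%:R.
  rewrite /full -(subnKC leX) big_split_ord /= addrAC subrr add0r.
  apply/andP; split; first by apply: sumr_ge0.
  apply: (@le_trans _ _ (\sum_(j < X * b.+1 - (X - b.+1))
     M * ((X + j).+1%:R * (b.+1%:R + (X + j).+1%:R))^-1)).
    apply: ler_sum => j _; rewrite /G addnS addnA subnKC//.
    have bXj : (b <= X + j)%N by rewrite (leq_trans (ltnW bX))// leq_addr.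
    by have /andP[] := pair_weight_bounds fM bXj.
  by rewrite -mulr_sumr; apply: ler_wpM2l => //; exact: tail_inv_sqr.
move: split1 split2 => /andP[h1 h2] /andP[h3 h4].
have -> : 2 * M / X%:R = M / X%:R + M / X%:R by ring.
by apply/andP; split; lra.
Qed.

(** For both functions the sum is, up to 2 M, the sum for f over the pairs with
b < c <= X: for U f by [row_sum_op_bounds], for f by omitting the diagonal. *)
Lemma lattice_sum_op f M X : unit_bounded f 0 M ->
  `|lattice_sum (gauss_op f) X - lattice_sum f X| <= 2 * M.
Proof.
move=> fM; have M0 := unit_bounded_ge0 fM.
case: (posnP X) => [->|X0].
  by rewrite /lattice_sum !big_ord0 subr0 normr0 mulr_ge0.
have x0 : 0 < X%:R :> R by rewrite ltr0n.
pose T := \sum_(b < X) \sum_(i < X - b.+1) pair_weight f b.+1 (b.+1 + i.+1).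
have h1 : 0 <= lattice_sum (gauss_op f) X - T <= 2 * M.
  rewrite /lattice_sum /T -sumrB; apply/andP; split.
    by apply: sumr_ge0 => b _; have /andP[] := row_sum_op_bounds fM (ltn_ord b).
  apply: (@le_trans _ _ (\sum_(b < X) 2 * M / X%:R)).
    by apply: ler_sum => b _; have /andP[] := row_sum_op_bounds fM (ltn_ord b).
  by rewrite sumr_const card_ord -[leLHS]mulr_natr mulfVK// gt_eqF.
(* Only the diagonal is missing from T, and its weight is at most the sum of M / c^2. *)
have h2 : 0 <= lattice_sum f X - T <= 2 * M.
  rewrite /lattice_sum /T sum_triangle -sumrB; apply/andP; split.
    apply: sumr_ge0 => c _; rewrite big_ord_recr /= addrAC subrr add0r.
    by have /andP[] := pair_weight_bounds fM (leqnn c).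
  apply: (@le_trans _ _ (\sum_(c < X) M * (c.+1%:R ^+ 2)^-1)).
    apply: ler_sum => c _; rewrite big_ord_recr /= addrAC subrr add0r.
    have /andP[_ /le_trans] := pair_weight_bounds fM (leqnn c); apply.
    apply: ler_wpM2l => //; rewrite lef_pV2 ?posrE ?mulr_gt0 ?addr_gt0 ?exprn_gt0//.
    by rewrite expr2 ler_wpM2l// lerDl.
  by rewrite -mulr_sumr mulrC; apply: ler_wpM2r => //; exact: sum_inv_sqr_le2.
move: h1 h2 => /andP[a1 a2] /andP[b1 b2].
by rewrite ler_norml; apply/andP; split; lra.
Qed.

Lemma lattice_sum_iter f M L X : unit_bounded f 0 M -> unit_nondecreasing f ->
  `|lattice_sum (gauss_iter f L) X - lattice_sum f X| <= 4 * M * L%:R.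
Proof.
move=> fM fmono; elim: L => [|L]; first by rewrite mulr0 subrr normr0.
have [LM _] := gauss_iter_class L fM fmono.
have := lattice_sum_op X LM; have := lattice_sum_op X (unit_bounded_gauss_op LM).
rewrite -/(gauss_op2 _) [gauss_iter f L.+1]/= -natr1.
rewrite -[gauss_op (gauss_op _)]/(gauss_op2 (gauss_iter f L)).
move: (lattice_sum _ X) (lattice_sum (gauss_op _) X) (lattice_sum (gauss_iter f L) X).
move=> x y z; rewrite !ler_norml => /andP[a1 a2] /andP[b1 b2] /andP[c1 c2].
by apply/andP; split; lra.
Qed.
End lattice_sums.

(** * The constant selected by the lattice sums *)

Section invariant_mean.
Context {R : realType}.
Implicit Types (f : R -> R) (M c : R) (u : nat -> R).

Lemma harmonic_unbounded (C : R) : exists X, C < \sum_(k < X) (k.+1%:R)^-1.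
Proof.
apply: contrapT => /forallNP H; apply: (@dvg_harmonic R).
apply: nondecreasing_is_cvgn.
  by apply/nondecreasing_seqP => n; rewrite /series /= big_nat_recr//= lerDl invr_ge0.
exists C => _ [n _ <-]; rewrite seriesEord /= leNgt; apply/negP; exact: H.
Qed.

(** A weighted form of the Cesaro lemma. *)
Lemma harmonic_sum_small u (e : R) : 0 < e -> u @ \oo --> 0 ->
  exists C, forall X, `|\sum_(k < X) u k / k.+1%:R| <=
    C + e * \sum_(k < X) (k.+1%:R)^-1.
Proof.
move=> e0 /cvgr0Pnorm_le /(_ _ e0) [N _ HN].
exists (\sum_(k < N) `|u k|) => X.
have ku (k : nat) : `|u k / k.+1%:R| <= `|u k|.
  rewrite normf_div ler_pdivrMr ?normr_gt0 ?pnatr_eq0// ler_peMr//.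
  by rewrite ger0_norm// ler1n.
have step d : `|\sum_(k < N + d) u k / k.+1%:R| <=
    \sum_(k < N) `|u k| + e * \sum_(k < N + d) (k.+1%:R)^-1.
  rewrite big_split_ord [X in _ <= _ + e * X]big_split_ord /=.
  apply: le_trans (ler_normD _ _) _; apply: lerD.
    by apply: le_trans (ler_norm_sum _ _ _) _; apply: ler_sum => k _; exact: ku.
  apply: le_trans (ler_norm_sum _ _ _) _.
  apply: (@le_trans _ _ (e * \sum_(i < d) ((N + i).+1%:R)^-1)).
    rewrite mulr_sumr; apply: ler_sum => k _.
    rewrite normf_div (ger0_norm (ler0n _ _)) ler_pM2r ?invr_gt0//.
    by apply: HN => /=; exact: leq_addr.
  by rewrite ler_pM2l// lerDr sumr_ge0.
case: (leqP N X) => NX; first by rewrite -(subnKC NX); exact: step.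
apply: (@le_trans _ _ (\sum_(k < N) `|u k|)); last first.
  by rewrite lerDl mulr_ge0 ?(ltW e0)// sumr_ge0.
apply: le_trans (ler_norm_sum _ _ _) _.
rewrite -(subnKC (ltnW NX)) big_split_ord /=.
apply: (@le_trans _ _ (\sum_(k < X) `|u k|)).
  by apply: ler_sum => k _; exact: ku.
by rewrite lerDl sumr_ge0.
Qed.

(** A Riemann sum, with step 1 / (B + 1), of f v / (1 + v) over [0, 1]. *)
Definition row_mean f B : R :=
  \sum_(a < B.+1) f (a.+1%:R / B.+1%:R) / (a.+1%:R + B.+1%:R).

Lemma lattice_sum_row f X :
  lattice_sum f X = \sum_(B < X) row_mean f B / B.+1%:R.
Proof.
apply: eq_bigr => B _; rewrite /row_mean mulr_suml; apply: eq_bigr => a _.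
by rewrite /pair_weight -mulrA -invfM [B.+1%:R * _]mulrC.
Qed.

Lemma row_mean1_ge B : 1 / 2 <= row_mean (cst 1) B.
Proof.
rewrite /row_mean; apply: (@le_trans _ _ (\sum_(a < B.+1) (1 / 2) / B.+1%:R)).
  rewrite sumr_const card_ord -[leRHS]mulr_natr mulfVK ?pnatr_eq0//.
apply: ler_sum => a _; rewrite /cst /= -mulrA -invfM !div1r.
rewrite lef_pV2 ?posrE ?mulr_gt0 ?addr_gt0// mulr_natl mulr2n lerD2r ler_nat ltnS.
by rewrite -ltnS.
Qed.

Lemma row_mean_bounds f m M B : (forall x, 0 < x <= 1 -> m <= f x <= M) ->
  m * row_mean (cst 1) B <= row_mean f B <= M * row_mean (cst 1) B.
Proof.
move=> fmM; rewrite /row_mean !mulr_sumr.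
have P a : 0 < (a.+1%:R + B.+1%:R)^-1 :> R by rewrite invr_gt0 addr_gt0.
apply/andP; split; apply: ler_sum => a _; rewrite /cst div1r ler_pM2r ?P//.
  by have /andP[] := fmM _ (frac_itv (R := R) (ltn_ord a : (a <= B)%N)).
by have /andP[] := fmM _ (frac_itv (R := R) (ltn_ord a : (a <= B)%N)).
Qed.

(** By [harmonic_sum_small] and the hypothesis, the lattice sum of f minus c times the
lattice sum of 1 is negligible against the harmonic sum. By [lattice_sum_iter] so is
the one for an iterate of f. If c were below all values of this iterate, or above all
of them, that difference would be at least a multiple of the harmonic sum. *)
Lemma lattice_mean f M c : unit_bounded f 0 M -> unit_nondecreasing f ->
  row_mean f B - c * row_mean (cst 1) B @[B --> \oo] --> 0 ->
  forall L m m', unit_bounded (gauss_iter f L) m m' -> m <= c <= m'.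
Proof.
move=> fM fmono Hc L m m' mE; have M0 := unit_bounded_ge0 fM.
pose H X : R := \sum_(k < X) (k.+1%:R)^-1.
pose Lam X : R := lattice_sum (cst 1) X.
have HLam X : H X <= 2 * Lam X.
  rewrite /H /Lam lattice_sum_row mulr_sumr; apply: ler_sum => B _.
  rewrite mulrA -[leLHS]mul1r ler_pM2r ?invr_gt0//.
  by have := row_mean1_ge B; lra.
have [Hm Hm'] : (forall X, m * Lam X <= lattice_sum (gauss_iter f L) X) /\
    forall X, lattice_sum (gauss_iter f L) X <= m' * Lam X.
  split => X; rewrite /Lam !lattice_sum_row mulr_sumr; apply: ler_sum => B _;
  rewrite mulrA ler_pM2r ?invr_gt0//; have /andP[] := row_mean_bounds B mE; by [].
have close e : 0 < e -> exists C, forall X,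
    `|lattice_sum (gauss_iter f L) X - c * Lam X| <= C + e * H X.
  move=> e0; have [C HC] := harmonic_sum_small e0 Hc.
  exists (C + 4 * M * L%:R) => X.
  have -> : lattice_sum (gauss_iter f L) X - c * Lam X =
     (lattice_sum (gauss_iter f L) X - lattice_sum f X) + (lattice_sum f X - c * Lam X).
    by rewrite addrA subrK.
  apply: le_trans (ler_normD _ _) _.
  have h1 := lattice_sum_iter L X fM fmono.
  have h2 : `|lattice_sum f X - c * Lam X| <= C + e * H X.
    apply: le_trans (HC X); rewrite /Lam !lattice_sum_row mulr_sumr -sumrB.
    by under eq_bigr do rewrite mulrA -mulrBl.
  by lra.
have noslack d : 0 < d -> (forall X, d * Lam X <= `|lattice_sum (gauss_iter f L) X - c * Lam X|) ->
    False.
  move=> d0 Hd; have d4 : 0 < d / 4 by rewrite divr_gt0.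
  have [C HC] := close _ d4.
  have [X HX] := harmonic_unbounded (4 * C / d).
  move: HX; rewrite ltr_pdivrMr// -/(H X) => HX.
  by have := Hd X; have := HC X; have := ler_wpM2l (ltW d0) (HLam X); lra.
apply/andP; split; rewrite leNgt; apply/negP => lt.
  apply: (noslack (m - c)); first by rewrite subr_gt0.
  by move=> X; rewrite mulrBl; apply: le_trans (ler_norm _); rewrite lerD2r.
apply: (noslack (c - m')); first by rewrite subr_gt0.
by move=> X; rewrite mulrBl distrC; apply: le_trans (ler_norm _); rewrite lerD2l lerN2.
Qed.

Lemma levy_fun_bounded : unit_bounded (@levy_fun R) 0 2.
Proof.
move=> x /andP[x0 x1]; have l0 : 0 <= ln (1 + x) by apply: ln_ge0; lra.
have l1 : ln (1 + x) <= x by apply: le_ln1Dx; lra.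
rewrite /levy_fun divr_ge0 ?mulr_ge0 ?(ltW x0)//=; last by lra.
by rewrite ler_pdivrMr//; nra.
Qed.

(** With r = (1 + x) / (1 + y), the bound ln r <= r - 1 gives an upper bound of ln (1 + x)
by ln (1 + y), and what remains is ln (1 + x) <= x. *)
Lemma levy_fun_nondecreasing : unit_nondecreasing (@levy_fun R).
Proof.
move=> x y x0 xy y1; have y0 : 0 < y := lt_le_trans x0 xy.
rewrite /levy_fun ler_pdivrMr// mulrAC ler_pdivlMr//.
have lx : ln (1 + x) <= x by apply: le_ln1Dx; lra.
have E : ln (1 + x) = ln (1 + y) + ln (1 + (x - y) / (1 + y)).
  rewrite -lnM ?posrE; last 2 first.
  - by lra.
  - by rewrite -(@ltr_pM2r _ (1 + y)); [rewrite mul0r mulrDl mulfVK ?gt_eqF|]; lra.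
  by congr (ln _); field; rewrite gt_eqF//; lra.
have l2 : ln (1 + (x - y) / (1 + y)) <= (x - y) / (1 + y).
  by apply: le_ln1Dx; rewrite ltr_pdivlMr; lra.
have l3 : (1 + y) * ln (1 + x) <= (1 + y) * ln (1 + y) + (x - y).
  rewrite {1}E mulrDr lerD2l mulrC -ler_pdivlMr//; lra.
move: (ln (1 + x)) (ln (1 + y)) lx l3 => p q lx l3.
have := ler_wpM2l (ltW x0) l3; nra.
Qed.

Lemma levy_constant c :
  row_mean (@levy_fun R) B - c * row_mean (cst 1) B @[B --> \oo] --> 0 ->
  {ae @lebesgue_measure R, forall alpha : R, irrational alpha ->
    ln (cf_den alpha n)%:~R / n%:R @[n --> \oo] --> c}.
Proof.
move=> Hc.
have Havg := avg_cvg levy_fun_bounded levy_fun_nondecreasing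
  (fun L m => lattice_mean levy_fun_bounded levy_fun_nondecreasing Hc (m' := _)).
apply: negligibleS (negligibleU Havg ln_den_levy_fun).
move=> alpha Hneg; apply: contrapT => /not_orP[/contrapT k0 /contrapT k1].
apply: Hneg => ia; have {}k0 := k0 ia; have {}k1 := k1 ia.
apply: (@eq_cvgn R (fun n => avg (@levy_fun R) alpha n +
  (ln (cf_den alpha n)%:~R / n%:R - avg (@levy_fun R) alpha n)) _ _ 0%N).
  by move=> n _; rewrite addrC subrK.
by rewrite -[X in _ --> X]addr0; apply: cvgD; [exact: k0|exact: k1].
Qed.
End invariant_mean.

(** * The alternating sum of inverse squares *)

Section alternating_inverse_squares.
Context {R : realType}.
Implicit Types (x y : R) (n k m : nat).

Lemma derive_ge0_le (g dg : R -> R) x : 0 <= x ->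
  (forall y, 0 <= y <= x -> is_derive y 1 g (dg y)) ->
  (forall y, 0 <= y <= x -> 0 <= dg y) -> g 0 <= g x.
Proof.
move=> x0 Hd Hp.
have oo y : y \in `]0, x[ -> 0 <= y <= x.
  by rewrite in_itv /= => /andP[a b]; rewrite !ltW.
apply: (@ger0_derive1_le_cc R g 0 x) => //.
- by move=> y /oo /Hd h; exact: ex_derive.
- by move=> y /oo yx; rewrite derive1E (@derive_val _ _ _ _ _ _ _ (Hd y yx)) Hp.
- by apply: derivable_within_continuous => y; rewrite in_itv /= => /Hd h; exact: ex_derive.
- by rewrite in_itv /= lexx.
- by rewrite in_itv /= lexx andbT.
Qed.

Lemma sin_le_id x : 0 <= x -> sin x <= x.
Proof.
move=> x0; rewrite -subr_ge0.
have h : 0 - sin 0 <= x - sin x.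
  have hd y : 0 <= y <= x -> is_derive y (1 : R) (id - @sin R) (1 - cos y).
    by move=> _; exact: (is_deriveB (is_derive_id y (1 : R)) (is_derive_sin y)).
  by apply: (derive_ge0_le x0 hd) => y _; rewrite subr_ge0 cos_le1.
by rewrite sin0 subr0 in h.
Qed.

Lemma id_le_tan x : 0 <= x -> x < pi / 2 -> x <= tan x.
Proof.
move=> x0 xpi; rewrite -subr_ge0.
have cosy y : 0 <= y <= x -> 0 < cos y.
  move=> /andP[y0 yx]; apply: cos_gt0_pihalf; rewrite (le_lt_trans yx xpi) andbT.
  by rewrite (lt_le_trans _ y0)// oppr_lt0 divr_gt0// pi_gt0.
have h : tan 0 - 0 <= tan x - x.
  have hd y : 0 <= y <= x -> is_derive y (1 : R) (@tan R - id) ((cos y)^-2 - 1).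
    move=> /cosy c0.
    exact: (is_deriveB (is_derive_tan (lt0r_neq0 c0)) (is_derive_id y (1 : R))).
  apply: (derive_ge0_le x0 hd) => y /cosy c0.
  by rewrite subr_ge0 invf_ge1 ?exprn_gt0// expr_le1 ?(ltW c0)// cos_le1.
by rewrite tan0 subr0 in h.
Qed.

Lemma sum_fold (F : nat -> R) m :
  \sum_(k < m + m) F k = \sum_(k < m) (F k + F (m + m - k.+1)%N).
Proof.
rewrite big_split_ord big_split /=; congr (_ + _).
rewrite (reindex_inj rev_ord_inj) /=; apply: eq_bigr => k _; congr F.
by rewrite addnBA.
Qed.

(** The odd multiples of pi / 2^(n+2), which lie in (0, pi / 2) for k < 2^n. *)
Definition odd_angle n k : R := (k.*2.+1)%:R * pi / (2 ^ n.+2)%:R.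

Lemma odd_angle_itv n k : (k < 2 ^ n)%N -> 0 < odd_angle n k < pi / 2.
Proof.
move=> kn; have p0 : 0 < pi :> R := pi_gt0 R.
have d0 : 0 < (2 ^ n.+2)%:R :> R by rewrite ltr0n expn_gt0.
apply/andP; split; first by rewrite /odd_angle divr_gt0// mulr_gt0.
rewrite /odd_angle ltr_pdivrMr// mulrAC ltr_pdivlMr//.
rewrite mulrAC [ltRHS]mulrC ltr_pM2r// -natrM ltr_nat.
by rewrite !expnS; lia.
Qed.

Lemma csc_sqr_fold y : 0 < y < pi / 2 ->
  (sin y)^-2 + (sin (pi / 2 - y))^-2 = 4 * (sin (2 * y))^-2.
Proof.
move=> /andP[y0 y1]; have s0 : 0 < sin y by rewrite sin_gt0_pihalf// y0.
have c0 : 0 < cos y.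
  by apply: cos_gt0_pihalf; rewrite y1 andbT (lt_trans _ y0)// oppr_lt0 divr_gt0// pi_gt0.
have -> : sin (pi / 2 - y) = cos y by rewrite addrC sinDpihalf cosN.
have -> : sin (2 * y) = 2 * (cos y * sin y) by rewrite mulr_natl sin_mulr2n mulr_natl.
have E := cos2Dsin2 y; move: (sin y) (cos y) s0 c0 E => s c s0 c0 E.
have -> : s ^- 2 + c ^- 2 = (c ^+ 2 + s ^+ 2) / (c ^+ 2 * s ^+ 2).
  by field; rewrite !gt_eqF.
by rewrite E; field; rewrite !gt_eqF.
Qed.

(** The angles k and 2^n - 1 - k add up to pi / 2. Folding the sum combines 1 / sin^2 and
1 / cos^2 of an angle into 4 / sin^2 of the double angle, an angle of the previous
level. *)
Lemma sum_csc_sqr n : \sum_(k < 2 ^ n) (sin (odd_angle n k))^-2 = 2 * 4 ^+ n.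
Proof.
elim: n => [|n ih].
  rewrite expn0 big_ord1 expr0 mulr1 /odd_angle mul1r.
  have y4 : (0 : R) < (pi / (2 ^ 2)%:R : R) < pi / 2.
    have p0 : 0 < pi :> R := pi_gt0 R.
    by rewrite divr_gt0//= ltr_pM2l// ltf_pV2 ?posrE// ltr_nat.
  have := csc_sqr_fold y4.
  have -> : pi / 2 - pi / (2 ^ 2)%:R = pi / (2 ^ 2)%:R :> R by rewrite natrX; field.
  have -> : 2 * (pi / (2 ^ 2)%:R) = pi / 2 :> R by rewrite natrX; field.
  by rewrite sin_pihalf expr1n invr1; lra.
rewrite expnS mul2n -addnn.
rewrite (sum_fold (fun k => (sin (odd_angle n.+1 k))^-2)) exprS mulrCA -ih mulr_sumr.
apply: eq_bigr => k _.
have kn : (k < 2 ^ n.+1)%N by rewrite expnS mul2n -addnn (leq_trans (ltn_ord k))// leq_addr.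
have -> : odd_angle n k = 2 * odd_angle n.+1 k.
  rewrite /odd_angle !natrX [2 ^+ n.+3]exprS.
  by field; rewrite expf_neq0// pnatr_eq0.
rewrite -csc_sqr_fold ?odd_angle_itv//; congr (_ + (sin _) ^- 2).
rewrite /odd_angle.
have kn' := ltn_ord k.
have -> : ((2 ^ n + 2 ^ n - k.+1).*2.+1 = 2 ^ n.+2 - k.*2.+1)%N.
  by rewrite !expnS; lia.
rewrite natrB; last by rewrite !expnS; lia.
rewrite mulrBl mulrBl; congr (_ - _).
rewrite !natrX [2 ^+ n.+3]exprS.
by field; rewrite expf_neq0// pnatr_eq0.
Qed.

Definition odd_sqr_sum m : R := \sum_(k < m) ((k.*2.+1)%:R ^+ 2)^-1.

(** On (0, pi / 2) the number 1 / y^2 lies between 1 / tan^2 y = 1 / sin^2 y - 1 and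
1 / sin^2 y. *)
Lemma odd_sqr_sum_bounds n :
  pi ^+ 2 / 8 - pi ^+ 2 / 16 / 2 ^+ n <= odd_sqr_sum (2 ^ n) <= pi ^+ 2 / 8.
Proof.
have p0 : 0 < pi :> R := pi_gt0 R.
have two0 : 0 < 2 ^+ n :> R by rewrite exprn_gt0.
have H : 2 * 4 ^+ n - 2 ^+ n <=
    \sum_(k < 2 ^ n) (odd_angle n k) ^- 2 <= 2 * 4 ^+ n.
  rewrite -sum_csc_sqr; apply/andP; split; last first.
    apply: ler_sum => k _; have /andP[y0 y1] := odd_angle_itv (ltn_ord k).
    have s0 : 0 < sin (odd_angle n k) by rewrite sin_gt0_pihalf// y0.
    rewrite lef_pV2 ?posrE ?exprn_gt0// ler_sqr ?nnegrE ?(ltW s0) ?(ltW y0)//.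
    exact: sin_le_id (ltW y0).
  have -> : 2 ^+ n = \sum_(k < 2 ^ n) (1 : R) by rewrite sumr_const card_ord natrX.
  rewrite -sumrB; apply: ler_sum => k _.
  have /andP[y0 y1] := odd_angle_itv (ltn_ord k).
  have s0 : 0 < sin (odd_angle n k) by rewrite sin_gt0_pihalf// y0.
  have c0 : 0 < cos (odd_angle n k).
    by apply: cos_gt0_pihalf; rewrite y1 andbT (lt_trans _ y0)// oppr_lt0 divr_gt0.
  have T := id_le_tan (ltW y0) y1.
  have -> : (sin (odd_angle n k)) ^- 2 - 1 = (tan (odd_angle n k)) ^- 2.
    rewrite /tan; have E := cos2Dsin2 (odd_angle n k).
    move: (sin _) (cos _) s0 c0 E => s c s0 c0 E.
    have -> : s ^- 2 - 1 = (1 - s ^+ 2) / s ^+ 2 by field; rewrite gt_eqF.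
    by rewrite -E addrK; field; rewrite !gt_eqF.
  rewrite lef_pV2 ?posrE ?exprn_gt0//; last by rewrite divr_gt0.
  by rewrite ler_sqr ?nnegrE ?(ltW y0)// (le_trans (ltW y0)).
have E : \sum_(k < 2 ^ n) (odd_angle n k) ^- 2 =
    16 * 4 ^+ n / pi ^+ 2 * odd_sqr_sum (2 ^ n).
  rewrite /odd_sqr_sum mulr_sumr; apply: eq_bigr => k _.
  have -> : 4 ^+ n = 2 ^+ n * 2 ^+ n :> R by rewrite -exprMn -natrM.
  rewrite /odd_angle natrX (exprS 2 n.+1) (exprS 2 n).
  have k0 : (k.*2.+1)%:R != 0 :> R by rewrite pnatr_eq0.
  move: ((k.*2.+1)%:R) k0 (2 ^+ n) two0 => K K0 t t0.
  have pi0 := lt0r_neq0 p0; have tN0 := lt0r_neq0 t0.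
  clear H; move: (pi : R) p0 pi0 => P _ P0.
  by field; rewrite K0 P0.
move: H; rewrite E.
have -> : 4 ^+ n = 2 ^+ n * 2 ^+ n :> R by rewrite -exprMn -natrM.
move: (2 ^+ n) two0 (odd_sqr_sum _) => t t0 S.
rewrite (_ : 16 * (t * t) / pi ^+ 2 * S = 16 * (t * t) * S / pi ^+ 2); last by ring.
rewrite ler_pdivlMr ?exprn_gt0// ler_pdivrMr ?exprn_gt0//.
move=> /andP[h1 h2]; have q0 : 0 < pi ^+ 2 :> R by rewrite exprn_gt0.
move: (pi ^+ 2) q0 h1 h2 => q q0 h1 h2.
have tt0 : 0 < t * t by rewrite mulr_gt0.
apply/andP; split; last by rewrite -(ler_pM2l tt0); lra.
rewrite -(ler_pM2l tt0).
have -> : t * t * (q / 8 - q / 16 / t) = (2 * (t * t) - t) * q / 16 by field; rewrite gt_eqF.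
by lra.
Qed.

Lemma cvg_odd_sqr_sum : odd_sqr_sum m @[m --> \oo] --> (pi ^+ 2 / 8 : R).
Proof.
have mono a b : (a <= b)%N -> odd_sqr_sum a <= odd_sqr_sum b.
  by move=> /subnKC <-; rewrite /odd_sqr_sum big_split_ord /= lerDl sumr_ge0.
have ub m : odd_sqr_sum m <= pi ^+ 2 / 8.
  have /andP[_] := odd_sqr_sum_bounds m; apply: le_trans.
  by apply: mono; apply: ltnW; apply: ltn_expl.
apply/cvgrPdist_le => e e0.
have p0 : 0 < pi ^+ 2 / 16 :> R by rewrite divr_gt0// exprn_gt0// pi_gt0.
pose n := (Num.trunc (pi ^+ 2 / 16 / e)).+1.
have n2 : n%:R <= 2 ^+ n :> R.
  by rewrite -natrX ler_nat; apply: ltnW; apply: ltn_expl.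
have ne : pi ^+ 2 / 16 / 2 ^+ n <= e.
  rewrite ler_pdivrMr ?exprn_gt0// [e * _]mulrC -ler_pdivrMr//.
  exact: le_trans (ltW (truncnS_gt _)) n2.
exists (2 ^ n)%N => // m /= nm.
have /andP[lb _] := odd_sqr_sum_bounds n.
have := mono _ _ nm; have := ub m => h1 h2.
by rewrite ger0_norm; lra.
Qed.

Definition alt_sqr_sum m : R := \sum_(j < m) (-1) ^+ j / j.+1%:R ^+ 2.
Definition inv_sqr_sum m : R := \sum_(j < m) (j.+1%:R ^+ 2)^-1.

Lemma inv_sqr_double x : x != 0 -> (2 * x) ^- 2 = x ^- 2 / 4.
Proof. by move=> x0; field. Qed.

Lemma inv_sqr_sum_double m :
  inv_sqr_sum m.*2 = odd_sqr_sum m + inv_sqr_sum m / 4.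
Proof.
elim: m => [|m ih]; first by rewrite /inv_sqr_sum /odd_sqr_sum !big_ord0; lra.
move: ih; rewrite /inv_sqr_sum /odd_sqr_sum doubleS !big_ord_recr /= => ->.
rewrite -[m.*2.+2]doubleS -[m.+1.*2]mul2n natrM.
rewrite inv_sqr_double ?pnatr_eq0//; ring.
Qed.

Lemma alt_sqr_sum_double m :
  alt_sqr_sum m.*2 = odd_sqr_sum m - inv_sqr_sum m / 4.
Proof.
elim: m => [|m ih]; first by rewrite /alt_sqr_sum /inv_sqr_sum /odd_sqr_sum !big_ord0; lra.
move: ih; rewrite /alt_sqr_sum /inv_sqr_sum /odd_sqr_sum doubleS !big_ord_recr /= => ->.
rewrite -[m.*2.+2]doubleS -[m.+1.*2]mul2n natrM (exprS (-1) m.*2).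
have -> : (-1) ^+ m.*2 = 1 :> R by rewrite -signr_odd odd_double.
rewrite inv_sqr_double ?pnatr_eq0//; ring.
Qed.

(** If z is the sum of all inverse squares, then z = pi^2 / 8 + z / 4, and the alternating
sum is pi^2 / 8 - z / 4. *)
Lemma cvg_alt_sqr_sum : alt_sqr_sum m.*2 @[m --> \oo] --> (pi ^+ 2 / 12 : R).
Proof.
have cz : cvgn inv_sqr_sum.
  apply: nondecreasing_is_cvgn.
    by apply/nondecreasing_seqP => n; rewrite /inv_sqr_sum big_ord_recr /= lerDl.
  by exists 2 => _ [n _ <-]; exact: sum_inv_sqr_le2.
move/cvg_ex: cz => [z cz].
have cz2 : inv_sqr_sum m.*2 @[m --> \oo] --> z.
  apply: (cvg_comp _ _ _ cz) => A [N _ NA]; exists N => // m /= Nm; apply: NA => /=.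
  by rewrite -addnn (leq_trans Nm)// leq_addr.
have c4 : odd_sqr_sum m + inv_sqr_sum m / 4 @[m --> \oo] --> pi ^+ 2 / 8 + z / 4.
  by apply: cvgD; [exact: cvg_odd_sqr_sum|exact: cvgMr_tmp].
have c5 : inv_sqr_sum m.*2 @[m --> \oo] --> pi ^+ 2 / 8 + z / 4.
  apply: (@eq_cvgn R (fun m => odd_sqr_sum m + inv_sqr_sum m / 4) _ _ 0%N) => //.
  by move=> m _; exact: inv_sqr_sum_double.
have zE : z = pi ^+ 2 / 8 + z / 4.
  by have := cvg_lim (@Rhausdorff R) cz2; rewrite (cvg_lim (@Rhausdorff R) c5) => ->.
have -> : pi ^+ 2 / 12 = pi ^+ 2 / 8 - z / 4 by move: (pi ^+ 2) zE => q zE; lra.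
apply: (@eq_cvgn R (fun m => odd_sqr_sum m - inv_sqr_sum m / 4) _ _ 0%N).
  by move=> m _; exact: alt_sqr_sum_double.
by apply: cvgB; [exact: cvg_odd_sqr_sum|exact: cvgMr_tmp].
Qed.
End alternating_inverse_squares.

(** * Means over the fractions with a given denominator *)

Section row_means.
Context {R : realType}.
Implicit Types (v : R) (n B : nat).

Lemma cvg_shifted_inv : (B.+1%:R)^-1 @[B --> \oo] --> (0 : R).
Proof. exact: cvg_harmonic. Qed.

Lemma ln_step_ge (s : R) : 0 < s -> (s + 1)^-1 <= ln (s + 1) - ln s.
Proof.
move=> s0; have s1 : 0 < s + 1 by lra.
rewrite -opprB lerNr -ln_div ?posrE//.
have -> : s / (s + 1) = 1 + - (s + 1)^-1 by field; rewrite gt_eqF.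
by apply: le_ln1Dx; rewrite ltrN2 invf_lt1//; lra.
Qed.

Lemma telescope_ord (F : nat -> R) n :
  \sum_(a < n) (F a.+1 - F a) = F n - F 0%N.
Proof. by rewrite -(telescope_sumr _ (leq0n n)) big_mkord. Qed.

(** Each term lies between two successive differences of the logarithm. *)
Lemma cvg_row_mean1 : row_mean (cst 1) B @[B --> \oo] --> (ln 2 : R).
Proof.
have upper B : row_mean (cst 1) B <= ln 2 :> R.
  pose F a : R := ln (a%:R + B.+1%:R).
  have -> : ln 2 = F B.+1 - F 0%N :> R.
    rewrite /F add0r -ln_div ?posrE ?addr_gt0//; congr (ln _).
    have half (x : R) : x != 0 -> 2 = (x + x) / x by move=> ?; field.
    by apply: half; rewrite pnatr_eq0.
  rewrite -telescope_ord; apply: ler_sum => a _.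
  rewrite /cst div1r /F -[a.+1%:R]natr1 addrAC.
  by apply: ln_step_ge; rewrite ltr_wpDl.
have lower B : ln 2 - (B.+1%:R)^-1 <= row_mean (cst 1) B :> R.
  pose F a : R := ln (a%:R + B.+2%:R).
  apply: (@le_trans _ _ (F B.+1 - F 0%N)).
    rewrite /F add0r lerBlDl addrC -lerBlDl opprB addrA.
    have b0 : 0 <= B%:R :> R by [].
    have pB : 0 < B.+1%:R + B.+2%:R :> R by rewrite addr_gt0.
    have -> : ln 2 + ln B.+2%:R - ln (B.+1%:R + B.+2%:R) =
        ln (1 + (B.+1%:R + B.+2%:R)^-1) :> R.
      rewrite -lnM ?posrE// -ln_div ?posrE ?mulr_gt0//; congr (ln _).
      rewrite -[B.+2%:R]natr1 -[B.+1%:R]natr1.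
      by field; rewrite gt_eqF//; lra.
    apply: (@le_trans _ _ (B.+1%:R + B.+2%:R)^-1).
      by apply: le_ln1Dx; rewrite (lt_trans (ltrN10 R))// invr_gt0.
    by rewrite lef_pV2 ?posrE// lerDl.
  rewrite -telescope_ord; apply: ler_sum => a _.
  have E : a.+1%:R + B.+1%:R = a%:R + B.+2%:R :> R.
    by rewrite -[B.+2%:R]natr1 -[a.+1%:R]natr1; ring.
  rewrite /cst div1r /F E -[a.+1%:R]natr1 addrAC.
  by apply: ln_step; rewrite ltr_wpDl.
apply: (@squeeze_cvgr _ _ _ _ (fun B => ln 2 - (B.+1%:R)^-1) (fun=> ln 2)).
- by apply: nearW => B; rewrite lower upper.
- by rewrite -[X in _ --> X]subr0; apply: cvgB; [exact: cvg_cst|exact: cvg_shifted_inv].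
- exact: cvg_cst.
Qed.

(** A Riemann sum of v^n over [0, 1]. *)
Definition power_mean n B : R :=
  \sum_(a < B.+1) a.+1%:R ^+ n / B.+1%:R ^+ n.+1.

Lemma power_step (y : R) n : 0 <= y ->
  n.+1%:R * y ^+ n <= (y + 1) ^+ n.+1 - y ^+ n.+1 <= n.+1%:R * (y + 1) ^+ n.
Proof.
move=> y0; rewrite subrXX addrAC subrr add0r mul1r /= !mulr_natl.
have card x : x *+ n.+1 = \sum_(i < n.+1) x :> R by rewrite sumr_const card_ord.
have y1 : y <= y + 1 by lra.
have yp : 0 <= y + 1 by lra.
rewrite !card; apply/andP; split; apply: ler_sum => i _.
  rewrite -[in leLHS](subnK (ltn_ord i : (i <= n)%N)) exprD.
  by rewrite ler_wpM2r ?exprn_ge0// lerXn2r ?nnegrE.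
rewrite -[in leRHS](subnK (ltn_ord i : (i <= n)%N)) exprD.
by rewrite ler_wpM2l ?exprn_ge0// lerXn2r ?nnegrE.
Qed.

Lemma power_mean_bounds n B :
  1 <= n.+1%:R * power_mean n B <= (1 + (B.+1%:R)^-1) ^+ n.+1.
Proof.
have D0 : 0 < B.+1%:R ^+ n.+1 :> R by rewrite exprn_gt0.
rewrite /power_mean -mulr_suml mulrA ler_pdivlMr// mul1r ler_pdivrMr//.
rewrite -exprMn mulrDl mul1r mulVf ?pnatr_eq0// mulr_sumr; apply/andP; split.
  pose F a : R := a%:R ^+ n.+1.
  have -> : B.+1%:R ^+ n.+1 = F B.+1 - F 0%N by rewrite /F expr0n subr0.
  rewrite -telescope_ord; apply: ler_sum => a _; rewrite /F -[a.+1%:R]natr1.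
  by have /andP[] := power_step n (ler0n R a).
pose F a : R := a.+1%:R ^+ n.+1.
apply: (@le_trans _ _ (F B.+1 - F 0%N)); last first.
  by rewrite /F expr1n -[B.+2%:R]natr1 gerBl.
rewrite -telescope_ord; apply: ler_sum => a _; rewrite /F -[a.+2%:R]natr1.
by have /andP[] := power_step n (ler0n R a.+1).
Qed.

Lemma cvg_power_mean n : power_mean n B @[B --> \oo] --> (n.+1%:R^-1 : R).
Proof.
have c : n.+1%:R * power_mean n B @[B --> \oo] --> (1 : R).
  apply: (@squeeze_cvgr _ _ _ _ (fun=> 1) (fun B => (1 + (B.+1%:R)^-1) ^+ n.+1)).
  - by apply: nearW => B; exact: power_mean_bounds.
  - exact: cvg_cst.
  - rewrite -[X in _ --> X](expr1n _ n.+1).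
    have c1 : 1 + (B.+1%:R)^-1 @[B --> \oo] --> (1 : R).
      by rewrite -[X in _ --> X]addr0; apply: cvgD; [exact: cvg_cst|exact: cvg_shifted_inv].
    exact: (cvg_comp _ _ c1 (@exprn_continuous R n.+1 1)).
apply: (@eq_cvgn R (fun B => n.+1%:R^-1 * (n.+1%:R * power_mean n B)) _ _ 0%N).
  by move=> B _; rewrite mulKf// pnatr_eq0.
by rewrite -[X in _ --> X]mulr1; exact: cvgMl_tmp.
Qed.

Lemma power_mean_le1 n B : power_mean n B <= 1.
Proof.
rewrite /power_mean; apply: (@le_trans _ _ (\sum_(a < B.+1) (B.+1%:R)^-1 : R)).
  apply: ler_sum => a _; rewrite ler_pdivrMr ?exprn_gt0// exprS mulrA mulVf ?pnatr_eq0// mul1r.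
  by rewrite lerXn2r ?nnegrE// ler_nat.
by rewrite sumr_const card_ord -[leLHS]mulr_natr mulVf ?pnatr_eq0.
Qed.

Definition log_series n v : R := \sum_(j < n) (-1) ^+ j / j.+1%:R * v ^+ j.+1.

Lemma is_derive_pow n v : is_derive v (1 : R) (fun x : R => x ^+ n.+1) (n.+1%:R * v ^+ n).
Proof.
have -> : (fun x : R => x ^+ n.+1) = (@id R) ^+ n.+1 by apply/funext => x; rewrite fctE.
have := is_deriveX n.+1 (is_derive_id v (1 : R)).
by rewrite scaler1.
Qed.

Lemma is_derive_log_series n v :
  is_derive v (1 : R) (log_series n) (\sum_(j < n) (- v) ^+ j).
Proof.
elim: n => [|n ih].
  have -> : log_series 0 = cst 0 by apply/funext => x; rewrite /log_series big_ord0.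
  by rewrite big_ord0; exact: is_derive_cst.
have -> : log_series n.+1 = log_series n + ((-1) ^+ n / n.+1%:R) \*: (fun x : R => x ^+ n.+1).
  by apply/funext => x; rewrite /log_series big_ord_recr.
rewrite big_ord_recr /=.
have -> : (- v) ^+ n = ((-1) ^+ n / n.+1%:R) *: (n.+1%:R * v ^+ n).
  rewrite -[RHS]/((-1) ^+ n / n.+1%:R * (n.+1%:R * v ^+ n)).
  by rewrite [LHS]exprNn mulrA mulfVK ?pnatr_eq0.
exact: (is_deriveD ih (is_deriveZ _ (is_derive_pow n v))).
Qed.

(** The derivative of the error is (-y)^n / (1 + y), which is at most y^n in absolute value
for y >= 0. *)
Lemma log_series_err n v : 0 <= v ->
  `|ln (1 + v) - log_series n v| <= v ^+ n.+1 / n.+1%:R.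
Proof.
move=> v0.
pose g : R -> R := (fun x => ln (1 + x)) - log_series n.
pose q : R -> R := n.+1%:R^-1 \*: (fun x : R => x ^+ n.+1).
pose dg y : R := (1 + y)^-1 - \sum_(j < n) (- y) ^+ j.
have dgE (y : R) : 0 <= y -> dg y = (- y) ^+ n / (1 + y).
  move=> y0; have y1 : 1 + y != 0 by rewrite gt_eqF//; lra.
  have := subrX1 (- y) n; rewrite /dg.
  move: (\sum_(i < n) (- y) ^+ i) => S E.
  have {}E : (1 + y) * S = 1 - (- y) ^+ n by rewrite -[RHS]opprB E; ring.
  have -> : S = (1 - (- y) ^+ n) / (1 + y) by rewrite -E mulrAC mulfV// mul1r.
  by field.
have hg (y : R) : 0 <= y -> is_derive y (1 : R) g (dg y).
  move=> y0; apply: is_deriveB; last exact: is_derive_log_series.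
  have y1 : 0 < 1 + y by lra.
  have h1 : is_derive y (1 : R) (fun x : R => 1 + x) 1.
    rewrite -[X in is_derive _ _ _ X]add0r.
    exact: (is_deriveD (is_derive_cst (1 : R) y (1 : R)) (is_derive_id y (1 : R))).
  have := @is_derive1_comp R (@ln R) (fun x => 1 + x) y _ _ (is_derive1_ln y1) h1.
  by rewrite mulr1.
have hq (y : R) : is_derive y (1 : R) q (y ^+ n).
  have -> : y ^+ n = n.+1%:R^-1 *: (n.+1%:R * y ^+ n).
    by rewrite -[RHS]/(_ * _) mulKf// pnatr_eq0.
  exact: is_deriveZ (is_derive_pow n y).
have dgb (y : R) : 0 <= y -> `|dg y| <= y ^+ n.
  move=> y0; rewrite dgE// normf_div normrX normrN (ger0_norm y0).
  rewrite (ger0_norm (_ : 0 <= 1 + y)); last by lra.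
  rewrite ler_pdivrMr; last by lra.
  by rewrite ler_peMr ?exprn_ge0//; lra.
have q0 : q 0 = 0 by rewrite /q /= expr0n /= scaler0.
have g0 : g 0 = 0.
  rewrite /g -[LHS]/(ln (1 + 0) - log_series n 0) addr0 ln1 sub0r /log_series.
  by rewrite big1 ?oppr0// => j _; rewrite expr0n mulr0.
have qv : q v = v ^+ n.+1 / n.+1%:R by rewrite /q -[LHS]/(_ * _) mulrC.
have gv : g v = ln (1 + v) - log_series n v by [].
rewrite -gv -qv ler_norml; apply/andP; split.
  have hd (y : R) : 0 <= y <= v -> is_derive y (1 : R) (q + g) (y ^+ n + dg y).
    by move=> /andP[y0 _]; exact: (is_deriveD (hq y) (hg y y0)).
  have : (q + g) 0 <= (q + g) v.
    apply: (derive_ge0_le v0 hd) => y /andP[y0 _].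
    by have := dgb y y0; rewrite ler_norml => /andP[]; lra.
  rewrite -[leLHS]/(q 0 + g 0) -[leRHS]/(q v + g v) q0 g0; lra.
have hd (y : R) : 0 <= y <= v -> is_derive y (1 : R) (q - g) (y ^+ n - dg y).
  by move=> /andP[y0 _]; exact: (is_deriveB (hq y) (hg y y0)).
have : (q - g) 0 <= (q - g) v.
  apply: (derive_ge0_le v0 hd) => y /andP[y0 _].
  by have := dgb y y0; rewrite ler_norml => /andP[]; lra.
rewrite -[leLHS]/(q 0 - g 0) -[leRHS]/(q v - g v) q0 g0; lra.
Qed.

Lemma row_mean_levy B :
  row_mean (@levy_fun R) B = \sum_(a < B.+1) ln (1 + a.+1%:R / B.+1%:R) / a.+1%:R.
Proof.
apply: eq_bigr => a _; rewrite /levy_fun; move: (ln _) => l.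
rewrite -[B.+1%:R]natr1 -[a.+1%:R]natr1.
have b0 : 0 <= B%:R :> R by []. have a0 : 0 <= a%:R :> R by [].
by field; rewrite !gt_eqF//; lra.
Qed.

Definition alt_power_mean n B : R :=
  \sum_(j < n) (-1) ^+ j / j.+1%:R * power_mean j B.

Lemma cvg_alt_power_mean n :
  alt_power_mean n B @[B --> \oo] --> (alt_sqr_sum n : R).
Proof.
elim: n => [|n ih].
  rewrite /alt_sqr_sum big_ord0.
  apply: (@eq_cvgn R (fun=> 0) _ _ 0%N); last exact: cvg_cst.
  by move=> B _; rewrite /alt_power_mean big_ord0.
rewrite /alt_sqr_sum big_ord_recr /=.
apply: (@eq_cvgn R (fun B => alt_power_mean n B +
   (-1) ^+ n / n.+1%:R * power_mean n B) _ _ 0%N).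
  by move=> B _; rewrite /alt_power_mean big_ord_recr.
apply: cvgD; first exact: ih.
rewrite expr2 invfM mulrA; apply: cvgMl_tmp; exact: cvg_power_mean.
Qed.

Lemma power_quotient (x y : R) j : x != 0 -> x ^+ j / y ^+ j.+1 = (x / y) ^+ j.+1 / x.
Proof. by move=> x0; rewrite expr_div_n mulrAC (exprSr x) mulfK. Qed.

(** Replaces ln (1 + v) by the first n terms of its power series. The resulting error is
uniform in [B]. *)
Lemma row_mean_levy_err n B :
  `|row_mean (@levy_fun R) B - alt_power_mean n B| <= n.+1%:R^-1.
Proof.
rewrite row_mean_levy.
have -> : alt_power_mean n B =
    \sum_(a < B.+1) log_series n (a.+1%:R / B.+1%:R) / a.+1%:R.
  rewrite /alt_power_mean /power_mean.
  under eq_bigr do rewrite mulr_sumr.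
  rewrite exchange_big /=; apply: eq_bigr => a _.
  rewrite /log_series mulr_suml; apply: eq_bigr => j _.
  by rewrite power_quotient ?pnatr_eq0// mulrA.
rewrite -sumrB.
apply: (@le_trans _ _ (n.+1%:R^-1 * power_mean n B)); last first.
  by rewrite ler_piMr// power_mean_le1.
apply: le_trans (ler_norm_sum _ _ _) _.
rewrite /power_mean mulr_sumr; apply: ler_sum => a _.
have v0 : 0 <= a.+1%:R / B.+1%:R :> R by rewrite divr_ge0.
rewrite -mulrBl normf_div (ger0_norm (ler0n _ a.+1)) ler_pdivrMr//.
apply: le_trans (log_series_err n v0) _.
by rewrite power_quotient ?pnatr_eq0// mulrA mulfVK ?pnatr_eq0// mulrC.
Qed.

(** The n-th partial sum of the logarithm contributes, in the limit, the n-th partial sum of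
(-1)^j / (j + 1)^2, since the mean of v^j tends to 1 / (j + 1). *)
Lemma cvg_row_mean_levy :
  row_mean (@levy_fun R) B @[B --> \oo] --> (pi ^+ 2 / 12 : R).
Proof.
apply/cvgrPdist_le => e e0.
have e3 : 0 < e / 3 by rewrite divr_gt0.
have /cvgrPdist_le /(_ _ e3) [N _ HN] := @cvg_alt_sqr_sum R.
pose m := maxn N (Num.trunc (e / 3)^-1).+1.
have hm := HN m (leq_maxl _ _).
have m3 : (m.*2.+1%:R)^-1 <= e / 3 :> R.
  rewrite -[leRHS]invrK lef_pV2 ?posrE ?invr_gt0//.
  apply: (le_trans (ltW (truncnS_gt _))); rewrite ler_nat.
  apply: (leq_trans (leq_maxr N _)); rewrite -/m ltnW// ltnS -addnn; exact: leq_addr.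
have /cvgrPdist_le /(_ _ e3) [N' _ HN'] := @cvg_alt_power_mean m.*2.
exists N' => // B /= NB.
have h1 := HN' B NB; have h2 := row_mean_levy_err m.*2 B.
move: hm h1 h2; rewrite /= !ler_norml => /andP[a1 a2] /andP[b1 b2] /andP[c1 c2].
move: (pi ^+ 2 / 12) (m.*2.+1%:R^-1) m3 a1 a2 c1 c2 => q r m3 a1 a2 c1 c2.
by apply/andP; split; lra.
Qed.
End row_means.

(** * The theorem of Khinchin and Levy, and the conclusion *)

Lemma levy_constant_gt0 (R : realType) : 0 < pi ^+ 2 / 12 / ln 2 :> R.
Proof. by rewrite !divr_gt0 ?exprn_gt0 ?pi_gt0// ln_gt0// ltr1n. Qed.

Lemma khinchin_levy (R : realType) :
  {ae @lebesgue_measure R, forall alpha : R, irrational alpha ->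
    ln (cf_den alpha n)%:~R / n%:R @[n --> \oo] --> (pi ^+ 2 / 12 / ln 2 : R)}.
Proof.
apply: levy_constant.
have l2 : ln 2 != 0 :> R by rewrite gt_eqF// ln_gt0// ltr1n.
rewrite -(subrr (pi ^+ 2 / 12)).
apply: cvgB; first exact: cvg_row_mean_levy.
rewrite -[X in _ --> X](mulfVK l2).
by apply: cvgMl_tmp; exact: cvg_row_mean1.
Qed.

Theorem theorem1 (R : realType) :
  {ae @lebesgue_measure R, forall alpha : R, irrational alpha ->
    ((I_int alpha t / (cf_index alpha t)%:R) @[t --> +oo] --> (1 / 2 : R))
    /\ ((I_int alpha t / ln t) @[t --> +oo] --> (6 * ln 2 / pi ^+ 2 : R))}.
Proof.
apply: negligibleS (negligibleU (@cf_gap_mean R) (@khinchin_levy R)).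
move=> alpha Hneg; apply: contrapT => /not_orP[/contrapT gap /contrapT levy].
apply: Hneg => ia; have {}gap := gap ia; have {}levy := levy ia.
have HI := cvg_I_int_index ia gap.
split; first exact: HI.
have c0 := levy_constant_gt0 R.
have -> : 6 * ln 2 / pi ^+ 2 = 1 / 2 / (pi ^+ 2 / 12 / ln 2) :> R.
  have l2 : ln 2 != 0 :> R by rewrite gt_eqF// ln_gt0// ltr1n.
  have p0 : (pi : R) != 0 by rewrite gt_eqF// pi_gt0.
  by move: (pi : R) p0 => p p0; field; rewrite p0 l2.
exact: cvg_I_int_ln ia (lt0r_neq0 c0) HI levy.
Qed.
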